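(* Let $p$ be a prime, let $G$ be an elementary abelian $p$-group of rank $n$, and let $\Gamma$ be the maximal $\mathbb{Z}$-order of $\mathbb{Z}[G]$. For any $k\ge n+1$, $K_2(\mathbb{Z}[G]/(p^k))\cong K_2(\mathbb{Z}[G]/p^k\Gamma)$.
   Context: The maximal $\mathbb{Z}$-order $\Gamma$ of $\mathbb{Z}[G]$ is the maximal $\mathbb{Z}$-order in $\mathbb{Q}[G]$ containing $\mathbb{Z}[G]$; explicitly $\Gamma=\sum_{H\le G}\mathbb{Z}[G]e_H$ with $e_H=\frac1{|H|}\sum_{h\in H}h$. One has $p^n\Gamma\subseteq\mathbb{Z}[G]\subseteq\Gamma$, so $p^k\Gamma$ is an ideal of $\mathbb{Z}[G]$ for $k\ge n$. *)

(* Defs.v *)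
From HB Require Import structures.
From mathcomp Require Import all_boot all_order all_algebra.
From mathcomp Require Import all_fingroup all_solvable.
From mathcomp Require Import boolp.

Set Implicit Arguments.
Unset Strict Implicit.
Unset Printing Implicit Defensive.

(* generic_quotient.repr, not the repr of fingroup *)
Import generic_quotient GRing.Theory.

Local Open Scope ring_scope.
Local Open Scope quotient_scope.

(* The group ring R[G]: x : grpring R G stands for \sum_g (x g) g, with the
   convolution product.  It is an alias because {ffun G -> R} already carries
   the pointwise product. *)
Definition grpring (R : pzRingType) (G : finGroupType) : Type := {ffun G -> R^o}.

Section GroupRing.
Variables (R : pzRingType) (G : finGroupType).
Local Notation RG := (grpring R G).

HB.instance Definition _ := GRing.Lmodule.copy RG {ffun G -> R^o}.

Implicit Types x y z : RG.

Definition grpring_one : RG := [ffun g => (g == 1%g)%:R].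
Definition grpring_mul x y : RG :=
  [ffun g => \sum_(h : G) (x h : R) * y (h^-1 * g)%g].

Fact grpring_mulA : associative grpring_mul.
Proof.
move=> x y z; apply/ffunP=> g; rewrite !ffunE.
under eq_bigr => h _ do rewrite ffunE big_distrr /=.
under [RHS]eq_bigr => h _ do rewrite ffunE big_distrl /=.
rewrite [RHS]exchange_big /=; apply: eq_bigr => h _.
rewrite [RHS](reindex_inj (mulgI h)) /=; apply: eq_bigr => k _.
by rewrite mulrA invMg mulKg mulgA.
Qed.

Fact grpring_mul1r : left_id grpring_one grpring_mul.
Proof.
move=> x; apply/ffunP=> g; rewrite ffunE (bigD1 1%g) //= ffunE eqxx mul1r.
rewrite invg1 mul1g big1 ?addr0 // => h /negPf h1.
by rewrite ffunE h1 mul0r.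
Qed.

Fact grpring_mulr1 : right_id grpring_one grpring_mul.
Proof.
move=> x; apply/ffunP=> g; rewrite ffunE (bigD1 g) //= ffunE mulVg eqxx mulr1.
rewrite big1 ?addr0 // => h /negPf hg.
by rewrite ffunE -eq_mulVg1 hg mulr0.
Qed.

Fact grpring_mulDl : left_distributive grpring_mul +%R.
Proof.
move=> x y z; apply/ffunP=> g; rewrite !ffunE -big_split /=.
by apply: eq_bigr => h _; rewrite ffunE mulrDl.
Qed.

Fact grpring_mulDr : right_distributive grpring_mul +%R.
Proof.
move=> x y z; apply/ffunP=> g; rewrite !ffunE -big_split /=.
by apply: eq_bigr => h _; rewrite ffunE mulrDr.
Qed.

HB.instance Definition _ := GRing.Zmodule_isPzRing.Build RG
  grpring_mulA grpring_mul1r grpring_mulr1 grpring_mulDl grpring_mulDr.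

End GroupRing.

(* The inclusion of Z[G] into Q[G]. *)
Definition grpring_ZtoQ (G : finGroupType) (x : grpring int G) : grpring rat G :=
  [ffun g => (x g : int)%:~R : rat].

Section Orders.
Variable G : finGroupType.

(* A Z-order in Q[G]: a subring (with the same unit) that is finitely generated
   as a Z-module and spans Q[G] over Q. *)
Definition Zorder (L : {pred grpring rat G}) : Prop :=
  [/\ subring_closed L,
      exists m (s : m.-tuple (grpring rat G)),
        forall x, x \in L <-> inIntSpan s x
    & forall x, exists s : seq (rat * grpring rat G),
        {in s, forall u, u.2 \in L} /\ x = \sum_(u <- s) u.1 *: u.2].

Definition maximal_Zorder (L : {pred grpring rat G}) : Prop :=
  Zorder L /\
  forall L' : {pred grpring rat G},
    Zorder L' -> {subset L <= L'} -> {subset L' <= L}.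

Definition contains_ZG (L : {pred grpring rat G}) : Prop :=
  forall x : grpring int G, grpring_ZtoQ x \in L.

(* c L, as a subset of Z[G]. *)
Definition scaled_order (c : nat) (L : {pred grpring rat G})
    (x : grpring int G) : Prop :=
  exists2 y, y \in L & grpring_ZtoQ x = y *+ c.

End Orders.

Section RingQuotient.
Variables (R : pzRingType) (S : R -> Prop).

(* The two-sided ideal generated by S; it is S itself when S is an ideal. *)
Definition ideal_gen : {pred R} := fun x =>
  `[< exists t : seq (R * R * R),
        {in t, forall u, S u.1.2} /\ x = \sum_(u <- t) u.1.1 * u.1.2 * u.2 >].

Fact ideal_gen_zmod : zmod_closed ideal_gen.
Proof.
split=> [|x y /asboolP[s [sS ->]] /asboolP[t [tS ->]]]; apply/asboolP.
  by exists [::]; rewrite big_nil.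
exists (s ++ [seq (- u.1.1, u.1.2, u.2) | u <- t]); split.
  move=> u; rewrite mem_cat => /orP[/sS //|/mapP[v /tS vS ->] //].
rewrite big_cat big_map /=; congr (_ + _).
by rewrite -sumrN; apply: eq_bigr => u _; rewrite !mulNr.
Qed.

HB.instance Definition _ := GRing.isZmodClosed.Build R ideal_gen ideal_gen_zmod.

Fact ideal_gen_mull a x : x \in ideal_gen -> a * x \in ideal_gen.
Proof.
move=> /asboolP[s [sS ->]]; apply/asboolP.
exists [seq (a * u.1.1, u.1.2, u.2) | u <- s]; split.
  by move=> u /mapP[v /sS vS ->].
by rewrite big_map mulr_sumr; apply: eq_bigr => u _; rewrite !mulrA.
Qed.

Fact ideal_gen_mulr a x : x \in ideal_gen -> x * a \in ideal_gen.
Proof.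
move=> /asboolP[s [sS ->]]; apply/asboolP.
exists [seq (u.1.1, u.1.2, u.2 * a) | u <- s]; split.
  by move=> u /mapP[v /sS vS ->].
by rewrite big_map mulr_suml; apply: eq_bigr => u _; rewrite !mulrA.
Qed.

(* The quotient ring R / (S).  The library's {ideal_quot _} has a ring
   structure only for proper ideals of commutative rings, so only its additive
   structure is reused. *)
Definition ring_quot : Type := Quotient.quot ideal_gen.

HB.instance Definition _ := GRing.Zmodule.on ring_quot.
HB.instance Definition _ := EqQuotient.on ring_quot.

Definition ring_quot_pi (a : R) : ring_quot := \pi_(Quotient.quot ideal_gen) a.
Local Notation pi := ring_quot_pi.

Definition ring_quot_one : ring_quot := pi 1.
Definition ring_quot_mul (x y : ring_quot) : ring_quot := pi (repr x * repr y).

Fact ring_quot_piP (x : ring_quot) : exists a, x = pi a.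
Proof. by exists (repr x); rewrite /ring_quot_pi reprK. Qed.

Fact ring_quot_eqP a b : pi a = pi b <-> a - b \in ideal_gen.
Proof.
by rewrite /ring_quot_pi Quotient.idealrBE; split=> [->|/eqP].
Qed.

Fact ring_quot_piD a b : pi (a + b) = pi a + pi b.
Proof. by rewrite /ring_quot_pi !piE. Qed.

Fact ring_quot_piM a b : pi (a * b) = ring_quot_mul (pi a) (pi b).
Proof.
apply/ring_quot_eqP; set a' := repr (pi a); set b' := repr (pi b).
have reprP c : c - repr (pi c) \in ideal_gen.
  by rewrite Quotient.idealrBE reprK.
have -> : a * b - a' * b' = (a - a') * b + a' * (b - b').
  by rewrite mulrBl mulrBr addrA subrK.
by apply: rpredD; [apply: ideal_gen_mulr | apply: ideal_gen_mull].
Qed.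

Fact ring_quot_mulA : associative ring_quot_mul.
Proof.
move=> x y z; have [[a ->] [b ->] [c ->]] :=
  And3 (ring_quot_piP x) (ring_quot_piP y) (ring_quot_piP z).
by rewrite -!ring_quot_piM mulrA.
Qed.

Fact ring_quot_mul1r : left_id ring_quot_one ring_quot_mul.
Proof. by move=> x; have [a ->] := ring_quot_piP x; rewrite -ring_quot_piM mul1r. Qed.

Fact ring_quot_mulr1 : right_id ring_quot_one ring_quot_mul.
Proof. by move=> x; have [a ->] := ring_quot_piP x; rewrite -ring_quot_piM mulr1. Qed.

Fact ring_quot_mulDl : left_distributive ring_quot_mul +%R.
Proof.
move=> x y z; have [[a ->] [b ->] [c ->]] :=
  And3 (ring_quot_piP x) (ring_quot_piP y) (ring_quot_piP z).
by rewrite -ring_quot_piD -!ring_quot_piM -ring_quot_piD mulrDl.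
Qed.

Fact ring_quot_mulDr : right_distributive ring_quot_mul +%R.
Proof.
move=> x y z; have [[a ->] [b ->] [c ->]] :=
  And3 (ring_quot_piP x) (ring_quot_piP y) (ring_quot_piP z).
by rewrite -ring_quot_piD -!ring_quot_piM -ring_quot_piD mulrDr.
Qed.

HB.instance Definition _ := GRing.Zmodule_isPzRing.Build ring_quot
  ring_quot_mulA ring_quot_mul1r ring_quot_mulr1 ring_quot_mulDl ring_quot_mulDr.

End RingQuotient.

(* Words over X: the letter (x, false) stands for x and (x, true) for x^-1. *)
Section Presentation.
Variable X : choiceType.
Definition gword : Type := seq (X * bool).
HB.instance Definition _ := Choice.on gword.

Implicit Types u v w : gword.

Definition winv w : gword := rev [seq (l.1, ~~ l.2) | l <- w].
Definition wcomm u v : gword := u ++ v ++ winv u ++ winv v.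

Variable rel : gword -> gword -> Prop.

(* Equality of words in the group < X | u = v for rel u v >. *)
Inductive pres_eq : gword -> gword -> Prop :=
| PresRefl w : pres_eq w w
| PresSym u v : pres_eq u v -> pres_eq v u
| PresTrans u v w : pres_eq u v -> pres_eq v w -> pres_eq u w
| PresCat u u' v v' : pres_eq u u' -> pres_eq v v' -> pres_eq (u ++ v) (u' ++ v')
| PresCancel x b : pres_eq [:: (x, b); (x, ~~ b)] [::]
| PresRel u v : rel u v -> pres_eq u v.

Definition pres_eqb u v := `[< pres_eq u v >].

Fact pres_eqb_equiv : equiv_class_of pres_eqb.
Proof.
split=> [u|u v|v u w].
- by apply/asboolP; apply: PresRefl.
- by apply/asboolP/asboolP; apply: PresSym.
- by move=> /asboolP uv /asboolP vw; apply/asboolP; apply: PresTrans uv vw.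
Qed.

Canonical pres_eqb_equivRel := EquivRelPack pres_eqb_equiv.

Definition presgroup : Type := {eq_quot pres_eqb}.
HB.instance Definition _ := Choice.on presgroup.
HB.instance Definition _ := EqQuotient.on presgroup.

Definition presclass (w : gword) : presgroup := \pi_({eq_quot pres_eqb}) w.

Fact presclassP u v : presclass u = presclass v <-> pres_eq u v.
Proof. by split=> [/eqquotP/asboolP //|uv]; apply/eqquotP/asboolP. Qed.

Fact presclass_repr x : presclass (repr x) = x.
Proof. exact: reprK. Qed.

Fact pres_eq_repr w : pres_eq (repr (presclass w)) w.
Proof. by apply/presclassP; rewrite presclass_repr. Qed.

Fact pres_eq_mulwV w : pres_eq (w ++ winv w) [::].
Proof.
elim: w => [|[x b] s IHs]; first exact: PresRefl.
rewrite /winv /= rev_cons -cats1 /= -cat1s (catA s).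
apply: PresTrans (PresCancel x b).
apply: (@PresCat [:: _] [:: _]); first exact: PresRefl.
exact: (@PresCat _ [::] [:: _]) IHs (PresRefl _).
Qed.

Fact pres_eq_mulVw w : pres_eq (winv w ++ w) [::].
Proof.
have winvK : winv (winv w) = w.
  rewrite /winv map_rev revK -map_comp -[RHS]map_id.
  by apply: eq_map => -[x b] /=; rewrite negbK.
by rewrite -{2}winvK; apply: pres_eq_mulwV.
Qed.

Fact pres_eq_winv u v : pres_eq u v -> pres_eq (winv u) (winv v).
Proof.
move=> uv; apply: PresSym.
have h1 : pres_eq (winv v) (winv u ++ u ++ winv v).
  rewrite catA; apply: PresSym.
  exact: (PresCat (pres_eq_mulVw u) (PresRefl (winv v))).
apply: PresTrans h1 _; rewrite -[X in pres_eq _ X]cats0.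
apply: PresCat; first exact: PresRefl.
exact: PresTrans (PresCat uv (PresRefl _)) (pres_eq_mulwV v).
Qed.

Definition pres_one : presgroup := presclass [::].
Definition pres_mul (x y : presgroup) : presgroup := presclass (repr x ++ repr y).
Definition pres_inv (x : presgroup) : presgroup := presclass (winv (repr x)).

Fact presclass_cat u v : presclass (u ++ v) = pres_mul (presclass u) (presclass v).
Proof.
by apply/presclassP/PresSym; apply: PresCat; apply: pres_eq_repr.
Qed.

Fact presclass_winv w : presclass (winv w) = pres_inv (presclass w).
Proof. by apply/presclassP/PresSym/pres_eq_winv/pres_eq_repr. Qed.

Fact pres_mulA : associative pres_mul.
Proof.
move=> x y z; rewrite -(presclass_repr x) -(presclass_repr y).
by rewrite -(presclass_repr z) -!presclass_cat catA.
Qed.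

Fact pres_mul1g : left_id pres_one pres_mul.
Proof. by move=> x; rewrite -(presclass_repr x) -presclass_cat. Qed.

Fact pres_mulg1 : right_id pres_one pres_mul.
Proof. by move=> x; rewrite -(presclass_repr x) -presclass_cat cats0. Qed.

Fact pres_mulVg : left_inverse pres_one pres_inv pres_mul.
Proof.
move=> x; rewrite -(presclass_repr x) -presclass_winv -presclass_cat.
exact/presclassP/pres_eq_mulVw.
Qed.

Fact pres_mulgV : right_inverse pres_one pres_inv pres_mul.
Proof.
move=> x; rewrite -(presclass_repr x) -presclass_winv -presclass_cat.
exact/presclassP/pres_eq_mulwV.
Qed.

HB.instance Definition _ := isGroup.Build presgroup
  pres_mulA pres_mul1g pres_mulg1 pres_mulVg pres_mulgV.

End Presentation.

Section Steinberg.
Variable R : pzRingType.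

(* (i, j, a) with i != j is the generator x_ij(a) of St(R); the indices range
   over nat, so St(R) is the stable Steinberg group. *)
Definition stgen : Type := {s : nat * nat * R | s.1.1 != s.1.2}.
HB.instance Definition _ := Choice.on stgen.

Definition stx (i j : nat) (ij : i != j) (a : R) : gword stgen :=
  [:: (exist _ (i, j, a) ij : stgen, false)].

Inductive steinberg_rel : gword stgen -> gword stgen -> Prop :=
| StAdd i j (ij : i != j) a b :
    steinberg_rel (stx ij a ++ stx ij b) (stx ij (a + b))
| StComm i j k (ij : i != j) (jk : j != k) (ik : i != k) a b :
    steinberg_rel (wcomm (stx ij a) (stx jk b)) (stx ik (a * b))
| StComm1 i j k l (ij : i != j) (kl : k != l) a b : j != k -> i != l ->
    steinberg_rel (wcomm (stx ij a) (stx kl b)) [::].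

Definition St : Type := presgroup steinberg_rel.
HB.instance Definition _ := Group.on St.

(* The N x N matrix with a in position (i, j) and 0 elsewhere; it is 0 if i or
   j is at least N. *)
Definition entry_mx N (i j : nat) (a : R) : 'M[R]_N :=
  \matrix_(r, s) (if (r == i :> nat) && (s == j :> nat) then a else 0).

(* e_ij(a), or e_ij(-a) for the formal inverse of x_ij(a). *)
Definition elem_mx N (l : stgen * bool) : 'M[R]_N :=
  let: (i, j, a) := val l.1 in 1%:M + entry_mx N i j ((-1) ^+ l.2 * a).

Definition word_mx N (w : gword stgen) : 'M[R]_N := \prod_(l <- w) elem_mx N l.

(* GL(R) is the union of the GL_N(R) along A |-> block_mx A 0 0 1, so two words
   have the same image in GL(R) iff their N x N matrices agree for all large N. *)
Definition eq_in_GL (u v : gword stgen) : Prop :=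
  exists N0, forall N, (N0 <= N)%N -> word_mx N u = word_mx N v.

Fact word_mx_cat N u v : word_mx N (u ++ v) = word_mx N u * word_mx N v.
Proof. by rewrite /word_mx big_cat. Qed.

Fact entry_mxD N i j a b :
  entry_mx N i j (a + b) = entry_mx N i j a + entry_mx N i j b.
Proof. by apply/matrixP=> r s; rewrite !mxE; case: ifP => _; rewrite ?addr0. Qed.

Fact entry_mxM N i j k l a b : (j < N)%N ->
  entry_mx N i j a * entry_mx N k l b = if j == k then entry_mx N i l (a * b) else 0.
Proof.
move=> jN; apply/matrixP=> r s; rewrite mxE (bigD1 (Ordinal jN)) //= big1 => [|t tj].
  rewrite addr0 !mxE /= eqxx andbT; case: (j == k); rewrite !mxE /=.
    by case: ifP => _; case: ifP => _; rewrite ?mul0r ?mulr0.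
  by rewrite mulr0.
rewrite !mxE -val_eqE /= in tj *.
by rewrite (negPf tj) andbF mul0r.
Qed.

Fact entry_mxN N i j a : entry_mx N i j (- a) = - entry_mx N i j a.
Proof. by apply/matrixP=> r s; rewrite !mxE; case: ifP => _; rewrite ?oppr0. Qed.

Fact elem_mx_mulV N (g : stgen) b : elem_mx N (g, b) * elem_mx N (g, ~~ b) = 1.
Proof.
rewrite /elem_mx /=; case: g => -[[i j] a] /= ij; set A := entry_mx N i j _.
have -> : entry_mx N i j ((-1) ^+ (~~ b) * a) = - A.
  by rewrite /A -entry_mxN -mulNr signrN.
have AA : A * A = 0.
  have [jN|jN] := ltnP j N; first by rewrite entry_mxM // eq_sym (negPf ij).
  suff -> : A = 0 by rewrite mul0r.
  apply/matrixP=> r s; rewrite !mxE; case: ifP => // /andP[_ /eqP sj].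
  by move: (ltn_ord s); rewrite sj ltnNge jN.
by rewrite mulrBr mulr1 mulrDl mul1r AA addr0 addrK.
Qed.

Fact word_mx_mulV N w : word_mx N w * word_mx N (winv w) = 1.
Proof.
elim: w => [|[g b] w IHw]; first by rewrite /word_mx !big_nil mulr1.
rewrite /winv map_cons rev_cons -cats1 word_mx_cat /word_mx big_cons.
by rewrite big_seq1 -mulrA [X in _ * X]mulrA IHw mul1r elem_mx_mulV.
Qed.

Fact comm_1D (S : pzRingType) (A B : S) :
  A * A = 0 -> B * B = 0 -> B * A = 0 ->
  (1 + A) * ((1 + B) * ((1 - A) * (1 - B))) = 1 + A * B.
Proof.
move=> AA BB BA.
have inv1D (C : S) : C * C = 0 -> (1 + C) * (1 - C) = 1.
  by move=> CC; rewrite mulrBr mulr1 mulrDl mul1r CC addr0 addrK.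
have -> : (1 + A) * ((1 + B) * ((1 - A) * (1 - B)))
    = (1 + A * B) * ((1 + B) * ((1 + A) * ((1 - A) * (1 - B)))).
  rewrite !mulrA; congr (_ * _ * _).
  have BA1 : (1 + B) * (1 + A) = 1 + B + A.
    by rewrite mulrDr mulr1 mulrDl mul1r BA addr0.
  rewrite -mulrA BA1 [RHS]mulrDl mul1r !mulrDr !mulr1 -!mulrA BB BA.
  by rewrite !mulr0 !addr0 mulrDl mul1r addrA [1 + A + B]addrAC.
by rewrite [(1 + A) * _]mulrA inv1D // mul1r inv1D // mulr1.
Qed.

Fact steinberg_rel_GL u v : steinberg_rel u v -> eq_in_GL u v.
Proof.
have wE N i j (ij : i != j) a : word_mx N (stx ij a) = 1 + entry_mx N i j a.
  by rewrite /word_mx big_seq1 /elem_mx /= expr0 mul1r.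
have cE N i j k l (ij : i != j) (kl : k != l) a b :
    (maxn (maxn i j) (maxn k l) < N)%N -> i != l ->
    word_mx N (wcomm (stx ij a) (stx kl b))
      = 1 + (if j == k then entry_mx N i l (a * b) else 0).
  rewrite !gtn_max => /andP[/andP[iN jN] /andP[kN lN]] il.
  rewrite /word_mx !big_cons big_nil mulr1 /elem_mx /=.
  rewrite expr0 expr1 !mul1r !mulN1r !entry_mxN.
  rewrite comm_1D ?entry_mxM //.
  - by rewrite eq_sym (negPf ij).
  - by rewrite eq_sym (negPf kl).
  - by rewrite eq_sym (negPf il).
case=> {u v} [i j ij a b|i j k ij jk ik a b|i j k l ij kl a b jk il].
- exists (maxn i j).+1 => N; rewrite gtn_max => /andP[iN jN].
  rewrite word_mx_cat !wE entry_mxD mulrDr mulr1 mulrDl mul1r entry_mxM //.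
  by rewrite eq_sym (negPf ij) addr0 -addrA.
- exists (maxn (maxn i j) (maxn j k)).+1 => N ltN.
  by rewrite cE // eqxx wE.
- exists (maxn (maxn i j) (maxn k l)).+1 => N ltN.
  by rewrite cE // (negPf jk) addr0 /word_mx big_nil.
Qed.

Fact steinberg_eq_GL u v : pres_eq steinberg_rel u v -> eq_in_GL u v.
Proof.
elim=> {u v} [w|u v _ [M E]|u v w _ [M E] _ [M' E']
  |u u' v v' _ [M E] _ [M' E']|g b|u v /steinberg_rel_GL//].
- by exists 0%N.
- by exists M => N /E.
- by exists (maxn M M') => N; rewrite geq_max => /andP[/E-> /E'->].
- exists (maxn M M') => N; rewrite geq_max !word_mx_cat => /andP[].
  by move=> /E-> /E'->.
- by exists 0%N => N _; rewrite /word_mx big_cons big_seq1 big_nil elem_mx_mulV.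
Qed.

Definition K2_pred : {pred St} := fun x =>
  `[< exists2 w, x = presclass steinberg_rel w & eq_in_GL w [::] >].

(* Membership does not depend on the word representing x. *)
Fact K2_predP w : presclass steinberg_rel w \in K2_pred <-> eq_in_GL w [::].
Proof.
split=> [/asboolP[v /presclassP/steinberg_eq_GL[M E] [M' E']]|w1].
  by exists (maxn M M') => N; rewrite geq_max => /andP[/E-> /E'->].
by apply/asboolP; exists w.
Qed.

Fact K2_group_closed : group_closed K2_pred.
Proof.
split; first by apply/K2_predP; exists 0%N.
move=> x y; rewrite -(presclass_repr x) -(presclass_repr y).
move=> /K2_predP[M E] /K2_predP[M' E'].
rewrite [X in X \in _](_ : _ = presclass _ (repr x ++ winv (repr y))); last first.
  by rewrite presclass_cat presclass_winv.
apply/K2_predP; exists (maxn M M') => N; rewrite geq_max => /andP[NM NM'].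
by rewrite word_mx_cat E // -{1}E' // word_mx_mulV /word_mx big_nil.
Qed.

(* The kernel of St(R) -> GL(R), as a group. *)
Definition K2 : Type := {x : St | x \in K2_pred}.
HB.instance Definition _ := SubChoice.on K2.
HB.instance Definition _ := SubChoice_isSubGroup.Build St K2_pred K2 K2_group_closed.

End Steinberg.

Definition group_iso (H K : groupType) : Prop :=
  exists f : {multiplicative H -> K}, bijective f.

(* Main.v *)
Require Import Defs.
From HB Require Import structures.
From mathcomp Require Import all_boot all_order all_algebra.
From mathcomp Require Import all_fingroup all_solvable all_field all_character.
From mathcomp Require Import boolp ring zify.

(* Characters show that p^n Gamma lies in Z[G], because |G| times a coefficient of
   an integral element is a rational algebraic integer.  Hence the kernel
   I = p^k Gamma / p^k of A = Z[G]/p^k -> B = Z[G]/p^k Gamma squares to zero.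

   K_2 is the kernel of the action of St on column vectors and is central, so a
   relation between commutators in St can be checked on matrices.  The kernel of
   St(A) -> St(B) is the normal closure of the x_ij(b), b in I.  It meets K_2(A)
   trivially as soon as the Dennis-Stein symbols <a, b>, b in I, vanish: it is
   then the abelian group generated by the x_ij(b) and lifts of diagonal
   matrices, and maps isomorphically onto the matrices of determinant 1
   congruent to 1 mod I; this gives injectivity as well as surjectivity.

   G generates A additively, so the vanishing reduces to the symbols {g, 1 + b}
   with g in G, up to elements of order 2 which die because b can be halved.  As
   g^p = 1, it suffices that 1 + b is a p-th power, and k > n makes it one; the
   only exception is p = 2, n = 1, k = 2, which is treated by hand. *)

Set Implicit Arguments.
Unset Strict Implicit.
Unset Printing Implicit Defensive.

Import generic_quotient GRing.Theory.
Local Open Scope ring_scope.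

(** * The action of St(R) on column vectors *)

(** The bound behind all exponents: p^m Gamma vanishes in A once m >= n + k. It gives I^2 = 0 and,
    as k - 1 >= n, makes p^(k-1) Gamma a subset of A annihilated by I. Both uses of k > n rest on
    this: for p = 2 the half of b = 2^k y is 2^(k-1) y, and 1 + p^(k-1) y is a first approximation
    to a p-th root of 1 + p^k y.

    Exchanging x_ij(a) and x_ji(b) leaves the torus element <a, b> h_ij(1 + ab) behind. The obstacle
    is that it depends on a and b and not only on ab. A factor can be moved from one argument to the
    other only if it is a unit, by conjugation with a diagonal lift; hence the need for additive
    generators of A that are units. Summing them costs symbols <b, b'> with both arguments in I,
    which are symmetric as well as antisymmetric and so have order 2. *)

Section Action.
Variable R : comPzRingType.
Implicit Types (i j k m N : nat) (a b : R) (v : nat -> R) (x y g : St R).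

(** Vectors are arbitrary sequences, so that one action replaces the matrices of all sizes N; by
    [eq_in_GL_act] it records exactly the image in GL(R). *)
Definition elem_act i j a v : nat -> R :=
  fun k => if k == i then v k + a * v j else v k.

Definition letter_act (l : stgen R * bool) : (nat -> R) -> nat -> R :=
  let: (i, j, a) := val l.1 in elem_act i j ((-1) ^+ l.2 * a).

Definition word_act (w : gword (stgen R)) v : nat -> R := foldr letter_act v w.

Definition basis_vec j : nat -> R := fun k => (k == j)%:R.

Definition word_bound (w : gword (stgen R)) : nat :=
  \max_(l <- w) (maxn (val l.1).1.1 (val l.1).1.2).+1.

Lemma word_bound_cons l w N : (word_bound (l :: w) <= N)%N =
  [&& ((val l.1).1.1 < N)%N, ((val l.1).1.2 < N)%N & (word_bound w <= N)%N].
Proof. by rewrite /word_bound big_cons geq_max gtn_max andbA. Qed.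

Lemma word_act_out w N v k : (word_bound w <= N)%N -> (N <= k)%N ->
  word_act w v k = v k.
Proof.
move=> + Nk; elim: w => //= -[[[[i j] a] ij] b] w IHw.
rewrite word_bound_cons /= => /and3P[iN _ wN].
rewrite /letter_act /elem_act /= IHw //; case: eqP => // ki.
by move: iN; rewrite -ki ltnNge Nk.
Qed.

Lemma word_act_mx w N v (i : 'I_N) : (word_bound w <= N)%N ->
  word_act w v i = \sum_j word_mx N w i j * v j.
Proof.
elim: w i => [|[[[[r s] a] rs] b] w IHw] i /=.
  rewrite /word_mx big_nil => _; rewrite (bigD1 i) //= mxE eqxx mul1r.
  by rewrite big1 ?addr0 // => j /negPf ji; rewrite mxE eq_sym ji mul0r.
rewrite word_bound_cons /= => /and3P[rN sN wN].
rewrite /letter_act /elem_act /= IHw // /word_mx big_cons -/(word_mx N w).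
rewrite /elem_mx /= mulrDl mul1r.
set c := (-1) ^+ b * a; pose s' := Ordinal sN.
have -> : \sum_j (word_mx N w + entry_mx N r s c * word_mx N w) i j * v j =
  \sum_j word_mx N w i j * v j + (if i == r :> nat then c * word_act w v s else 0).
  transitivity (\sum_j (word_mx N w i j * v j +
      (if i == r :> nat then c * (word_mx N w s' j * v j) else 0))).
    apply: eq_bigr => j _; rewrite mxE mulrDl; congr (_ + _).
    rewrite mxE (bigD1 s') //= big1 => [|t ts]; rewrite !mxE /=.
      by rewrite eqxx andbT addr0; case: ifP; rewrite ?mul0r ?mulrA.
    by rewrite -val_eqE /= in ts *; rewrite (negPf ts) andbF mul0r.
  rewrite big_split /=; congr (_ + _); case: ifP => _; last by rewrite big1.
  by rewrite -mulr_sumr -[s]/(val s') IHw.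
by case: ifP => _; rewrite ?addr0.
Qed.

Lemma eq_in_GL_act u w : eq_in_GL u w <-> word_act u = word_act w.
Proof.
split=> [[M uw]|uw].
  apply/funext => v; apply/funext => k.
  pose N := maxn (maxn M k.+1) (maxn (word_bound u) (word_bound w)).
  have /and4P[MN kN uN wN] : [&& M <= N, k < N, word_bound u <= N & word_bound w <= N]%N.
    by rewrite /N !leq_max !leqnn !orbT.
  by rewrite -[k]/(val (Ordinal kN)) !word_act_mx // uw.
exists (maxn (word_bound u) (word_bound w)) => N; rewrite geq_max => /andP[uN wN].
apply/matrixP=> i j.
have := congr1 (fun f => f (basis_vec j) (val i)) uw; rewrite !word_act_mx //.
have coef z : \sum_(k < N) word_mx N z i k * basis_vec j k = word_mx N z i j.
  rewrite (bigD1 j) //= /basis_vec eqxx mulr1 big1 ?addr0 // => k /negPf kj.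
  by rewrite val_eqE kj mulr0.
by rewrite !coef.
Qed.

Definition St_act x : (nat -> R) -> nat -> R := word_act (repr x).

Lemma St_act_class w : St_act (presclass (@steinberg_rel R) w) = word_act w.
Proof. exact/eq_in_GL_act/steinberg_eq_GL/pres_eq_repr. Qed.

Lemma St_act1 : St_act 1%g = id.
Proof. by rewrite St_act_class. Qed.

Lemma St_actM x y : St_act (x * y)%g = St_act x \o St_act y.
Proof. by rewrite St_act_class; apply/funext => v; rewrite /word_act foldr_cat. Qed.

Lemma K2P x : x \in @K2_pred R <-> St_act x = id.
Proof.
rewrite -{1}(presclass_repr x); split=> [/K2_predP/eq_in_GL_act|x1] //.
exact/K2_predP/eq_in_GL_act.
Qed.

Lemma St_actVK x : St_act x^-1%g \o St_act x = id.
Proof. by rewrite -St_actM mulVg St_act1. Qed.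

Lemma St_actKV x : St_act x \o St_act x^-1%g = id.
Proof. by rewrite -St_actM mulgV St_act1. Qed.

Local Notation cls := (presclass (@steinberg_rel R)).

Lemma St_classM (u w : gword (stgen R)) :
  cls (u ++ w) = (cls u * cls w : St R)%g.
Proof. exact: presclass_cat. Qed.

Lemma St_classV (w : gword (stgen R)) : cls (winv w) = ((cls w : St R)^-1)%g.
Proof. exact: presclass_winv. Qed.

(** The value 1 at i = j makes [sx] total: no proof of i != j is carried along, and additivity holds
    for all indices. *)
Definition sx i j a : St R :=
  if (i != j) =P true is ReflectT ij then presclass _ (stx ij a) else 1%g.

Lemma sxE i j (ij : i != j) a : sx i j a = presclass _ (stx ij a).
Proof.
by rewrite /sx; case: eqP => // ij'; rewrite (bool_irrelevance ij' ij).
Qed.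

Lemma sx_diag i a : sx i i a = 1%g.
Proof. by rewrite /sx; case: eqP => // ii; have := ii; rewrite eqxx. Qed.

Lemma St_act_sx i j a : i != j -> St_act (sx i j a) = elem_act i j a.
Proof.
move=> ij; rewrite (sxE ij) St_act_class /word_act /=.
by apply/funext => v; rewrite /letter_act /= expr0 mul1r.
Qed.

Lemma sxD i j a b : sx i j (a + b) = (sx i j a * sx i j b)%g.
Proof.
have [->|ij] := eqVneq i j; first by rewrite !sx_diag mulg1.
by rewrite !(sxE ij) -St_classM; apply/esym/presclassP/PresRel/StAdd.
Qed.

Lemma sx0 i j : sx i j 0 = 1%g.
Proof. by apply: (mulgI (sx i j 0)); rewrite -sxD addr0 mulg1. Qed.

Lemma sxN i j a : sx i j (- a) = (sx i j a)^-1%g.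
Proof. by apply/esym/mulg1_eq; rewrite -sxD subrr sx0. Qed.

Lemma St_class_comm (u w : gword (stgen R)) :
  cls (wcomm u w) = [~ (cls u : St R)^-1, (cls w : St R)^-1]%g.
Proof.
by rewrite /wcomm !St_classM !St_classV commgEl conjgE !invgK !mulgA.
Qed.

(** The signs reconcile two conventions: [[~ x, y]] is x^-1 y^-1 x y, while [wcomm] is u v u^-1
    v^-1. *)
Lemma sx_comm i j k a b : i != j -> j != k -> i != k ->
  [~ sx i j (- a), sx j k (- b)]%g = sx i k (a * b).
Proof.
move=> ij jk ik; rewrite !sxN !(sxE ij, sxE jk, sxE ik) -St_class_comm.
exact/presclassP/PresRel/StComm.
Qed.

Lemma sx_commute i j k l a b : j != k -> i != l ->
  commute (sx i j a) (sx k l b).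
Proof.
move=> jk il; have [->|ij] := eqVneq i j.
  by rewrite sx_diag; apply/commute_sym/commute1.
have [->|kl] := eqVneq k l; first by rewrite sx_diag; apply: commute1.
apply/commgP/eqP; rewrite -[a]opprK -[b]opprK.
rewrite [sx i j _]sxN [sx k l _]sxN (sxE ij) (sxE kl) -St_class_comm.
exact/presclassP/PresRel/StComm1.
Qed.

Lemma sx_mulC i j k a b : i != j -> j != k -> i != k ->
  (sx i j a * sx j k b = sx i k (a * b) * sx j k b * sx i j a)%g.
Proof.
move=> ij jk ik.
rewrite -(sx_comm _ _ ij jk ik) commgEl conjgE !sxN !invgK !mulgA.
by rewrite !mulgVK.
Qed.

(** As [x ^ y] is y^-1 x y, the exponent g^-1 makes conjugation a left action, like [St_act]. *)
Lemma sx_conj_l i j k a b : i != j -> j != k -> i != k ->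
  (sx j k b ^ (sx i j a)^-1 = sx i k (a * b) * sx j k b)%g.
Proof. by move=> ij jk ik; rewrite conjgE invgK mulgA sx_mulC // mulgK. Qed.

Lemma sx_conj_r i j k a b : k != i -> i != j -> k != j ->
  (sx k i b ^ (sx i j a)^-1 = sx k j (- (b * a)) * sx k i b)%g.
Proof.
move=> ki ij kj; rewrite conjgE invgK; apply: (mulIg (sx i j a)).
by rewrite mulgA mulgVK -mulgA sx_mulC // !mulgA -sxD addNr sx0 mul1g.
Qed.

Lemma sx_conj_id i j k m a b : j != k -> i != m ->
  (sx k m b ^ (sx i j a)^-1 = sx k m b)%g.
Proof.
by move=> jk im; rewrite conjgE invgK mulgA (sx_commute a b jk im) mulgK.
Qed.

Lemma St_ind (P : St R -> Prop) : P 1%g ->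
  (forall i j a x, i != j -> P x -> P (sx i j a * x)%g) -> forall x, P x.
Proof.
move=> P1 PM x; rewrite -(presclass_repr x); elim: (repr x) => // -[[[[i j] a] ij] b] w.
move=> Pw; rewrite -cat1s St_classM.
suff -> : cls [:: (exist _ (i, j, a) ij, b)] =
    sx i j ((-1) ^+ b * a) by apply: PM.
case: b; rewrite ?expr0 ?expr1 ?mul1r ?mulN1r ?sxN (sxE ij) //.
by rewrite -St_classV.
Qed.

End Action.

(** * Centrality of K_2 *)

Section Central.
Variable R : comPzRingType.
Implicit Types (i j k m N : nat) (a b : R) (v : nat -> R) (x y g : St R).

Lemma prodg_only (T : groupType) (J : eqType) (F : J -> T) (s : seq J) z :
  uniq s -> z \in s -> (forall k : J, k != z -> F k = 1%g) ->
  (\prod_(k <- s) F k)%g = F z.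
Proof.
move=> + + Fz; elim: s => //= k s IHs /andP[ks us]; rewrite inE big_cons.
case: eqP => [zk _|/eqP zk /= zs].
  rewrite -zk in ks *; rewrite big_seq big1 ?mulg1 // => t ts; apply: Fz.
  by apply: contraNneq ks => <-.
by rewrite Fz 1?eq_sym // mul1g IHs.
Qed.

(* Milnor's argument: St(R) acts by conjugation on the commuting elements
   x_kN(c), k < N, through its action on column vectors, and on the x_Nk(c)
   through the dual action. *)
Lemma conj_vec_prod (y : nat -> R -> St R) g i j c N v :
  (forall k a b, y k (a + b) = y k a * y k b)%g ->
  (forall k k' a b, commute (y k a) (y k' b)) ->
  (forall k b, (k < N)%N ->
     (y k b) ^ g = y i (if k == j then c * b else 0)%R * y k b)%g ->
  (i < N)%N -> (j < N)%N ->
  ((\prod_(k <- iota 0 N) y k (v k)) ^ g =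
    \prod_(k <- iota 0 N) y k (elem_act i j c v k))%g.
Proof.
move=> yD yC yJ iN jN; have y0 k : y k 0 = 1%g.
  by apply: (mulgI (y k 0)); rewrite -yD addr0 mulg1.
rewrite conjg_prod.
transitivity (\prod_(k <- iota 0 N)
    (y i (if k == j then c * v k else 0)%R * y k (v k)))%g.
  rewrite big_seq [RHS]big_seq; apply: eq_bigr => k.
  by rewrite mem_iota => /andP[_ kN]; rewrite yJ.
transitivity (\prod_(k <- iota 0 N)
    (y k (if k == i then c * v j else 0)%R * y k (v k)))%g.
  rewrite !prodgM_commute; try by move=> *; apply: yC.
  congr (_ * _)%g; rewrite (prodg_only (z := j)) ?iota_uniq ?mem_iota ?eqxx //;
    last by move=> k /negPf->.
  by rewrite (prodg_only (z := i)) ?iota_uniq ?mem_iota ?eqxx // => k /negPf->.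
apply: eq_bigr => k _; rewrite /elem_act -yD.
by case: ifP => _; rewrite ?add0r // addrC.
Qed.

Definition col_elt N v : St R := (\prod_(k <- iota 0 N) sx k N (v k))%g.
Definition row_elt N v : St R := (\prod_(k <- iota 0 N) sx N k (v k))%g.

Lemma conj_col_elt N i j a v : i != j -> (i < N)%N -> (j < N)%N ->
  (col_elt N v ^ (sx i j a)^-1 = col_elt N (elem_act i j a v))%g.
Proof.
move=> ij iN jN; apply: (conj_vec_prod (y := fun k => sx k N)) => //.
- by move=> *; apply: sxD.
- move=> k k' b b'; have [->|kN] := eqVneq k N.
    by rewrite sx_diag; apply/commute_sym/commute1.
  have [->|k'N] := eqVneq k' N; first by rewrite sx_diag; apply: commute1.
  by apply: sx_commute; rewrite // eq_sym.
move=> k b kN; case: eqP => [->|/eqP kj].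
  by rewrite sx_conj_l // ltn_eqF.
by rewrite sx0 mul1g sx_conj_id // 1?eq_sym // gtn_eqF.
Qed.

Lemma conj_row_elt N i j a v : i != j -> (i < N)%N -> (j < N)%N ->
  (row_elt N v ^ (sx i j a)^-1 = row_elt N (elem_act j i (- a) v))%g.
Proof.
move=> ij iN jN; apply: (conj_vec_prod (y := fun k => sx N k)) => //.
- by move=> *; apply: sxD.
- move=> k k' b b'; have [->|kN] := eqVneq k N.
    by rewrite sx_diag; apply/commute_sym/commute1.
  have [->|k'N] := eqVneq k' N; first by rewrite sx_diag; apply: commute1.
  by apply: sx_commute; rewrite // eq_sym.
move=> k b kN; case: eqP => [->|/eqP ki].
  have [Ni Nj] : N != i /\ N != j by rewrite !gtn_eqF.
  by rewrite sx_conj_r // mulNr mulrC.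
have jN' : j != N by rewrite ltn_eqF.
by rewrite sx0 mul1g sx_conj_id // eq_sym.
Qed.

(** The pairing identity makes [dual] contragredient to [St_act x]. It replaces a formula for
    [dual]: it already forces [dual] to fix the coordinates below N when [St_act x] is the
    identity. *)
Lemma act_conj_vec x : exists M (dual : (nat -> R) -> nat -> R),
  forall N, (M <= N)%N -> forall v,
  [/\ (col_elt N v ^ x^-1 = col_elt N (St_act x v))%g,
      (row_elt N v ^ x^-1 = row_elt N (dual v))%g
    & forall u, \sum_(k < N) dual v k * St_act x u k = \sum_(k < N) v k * u k].
Proof.
elim/St_ind: x => [|i j a x ij [M [dual MP]]].
  by exists 0%N, id => N _ v; rewrite invg1 !conjg1 St_act1.
exists (maxn M (maxn i j).+1), (elem_act j i (- a) \o dual) => N.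
rewrite geq_max gtn_max => /and3P[/MP{}MP iN jN] v; have [cP rP dP] := MP v.
rewrite invgM !conjgM cP rP conj_col_elt // conj_row_elt // St_actM St_act_sx //.
split=> // u; rewrite -dP /=; move: (dual v) (St_act x u) {cP rP dP} => {}v {}u.
rewrite (bigD1 (Ordinal iN)) //= (bigD1 (Ordinal jN)) /=; last first.
  by rewrite -val_eqE /= eq_sym.
rewrite [RHS](bigD1 (Ordinal iN)) //= [in RHS](bigD1 (Ordinal jN)) /=; last first.
  by rewrite -val_eqE /= eq_sym.
rewrite /elem_act !eqxx (negPf ij) [j == i]eq_sym (negPf ij) !addrA.
congr (_ + _); first by ring.
by apply: eq_bigr => k; rewrite -!val_eqE /= => /andP[/negPf-> /negPf->].
Qed.

(** As x_ij(a) is the commutator of x_iN(a) and x_Nj(1), generators with one index N above any bound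
    suffice; [act_conj_vec] concerns only such N. *)
Lemma St_vec_ind (P : St R -> Prop) M : (forall x y, P x -> P y -> P (x * y)%g) ->
  (forall x, P x -> P x^-1%g) ->
  (forall N k a, (M <= N)%N -> (k < N)%N -> P (sx k N a) /\ P (sx N k a)) ->
  forall x, P x.
Proof.
move=> PM PV PN; elim/St_ind => [|i j a x ij Px].
  by have [] := PN M.+1 0%N 0 (leqnSn _) (ltn0Sn _); rewrite sx0.
apply: (PM _ _ _ Px); pose N := maxn M (maxn i j).+1.
have /and3P[MN iN jN] : [&& M <= N, i < N & j < N]%N.
  by rewrite -gtn_max /N leq_max leqnn leq_maxr.
have [Pi _] := PN N i (- a) MN iN; have [_ Pj] := PN N j (- 1) MN jN.
have [iN' Nj'] : i != N /\ N != j by rewrite ltn_eqF ?gtn_eqF.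
rewrite -[a]mulr1 -(sx_comm _ _ iN' Nj' ij) commgEl conjgE.
exact: PM _ _ (PV _ Pi) (PM _ _ (PV _ Pj) (PM _ _ Pi Pj)).
Qed.

Theorem K2_central x y : x \in @K2_pred R -> commute x y.
Proof.
move=> /K2P x1; have [M [dual MP]] := act_conj_vec x.
have commE z : (z ^ x^-1 = z)%g -> commute x z.
  by rewrite conjgE invgK mulgA => /(congr1 (fun t => t * x)%g); rewrite mulgVK.
move: y; apply: (@St_vec_ind (commute x) M) => [y z|y|N k a MN kN].
- exact: commuteM.
- exact: commuteV.
(* With a single nonzero entry, [col_elt] and [row_elt] are the generators x_kN(a) and x_Nk(a). *)
pose v m : R := if m == k then a else 0.
have [+ + pair] := MP N MN v; rewrite x1.
have -> : row_elt N (dual v) = row_elt N v.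
  rewrite /row_elt big_seq [RHS]big_seq; apply: eq_bigr => m.
  rewrite mem_iota => /andP[_ mN]; congr (sx _ _ _).
  have := pair (basis_vec R m); rewrite x1.
  have coef (w : nat -> R) : \sum_(i < N) w i * basis_vec R m i = w m.
    rewrite (bigD1 (Ordinal mN)) //= /basis_vec eqxx mulr1 big1 ?addr0 // => i.
    by rewrite -val_eqE /= => /negPf->; rewrite mulr0.
  by rewrite !coef.
rewrite /col_elt /row_elt !(prodg_only (z := k)) ?iota_uniq ?mem_iota // /v ?eqxx; last 2 first.
- by move=> m /negPf->; rewrite sx0.
- by move=> m /negPf->; rewrite sx0.
by move=> /commE ? /commE.
Qed.

End Central.

(** * Lifting relations from GL(R) to St(R) *)

Section Lifts.
Variable R : comPzRingType.
Implicit Types (i j k m : nat) (a b u : R) (v d : nat -> R) (x y z g h t : St R).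

Lemma K2_eq x y : St_act x = St_act y -> exists2 z, z \in @K2_pred R & x = (y * z)%g.
Proof.
move=> xy; exists (y^-1 * x)%g; last by rewrite mulVKg.
by apply/K2P; rewrite St_actM xy -St_actM mulVg St_act1.
Qed.

Lemma St_actV_eq x y : St_act x = St_act y -> St_act x^-1%g = St_act y^-1%g.
Proof.
by move=> xy; rewrite -(mulgK y x^-1%g) !St_actM -xy -St_actM mulVg St_act1.
Qed.

Lemma comm_act_l x x' y : St_act x = St_act x' -> [~ x, y]%g = [~ x', y]%g.
Proof.
move=> /K2_eq[z zK ->]; rewrite !commgEl conjMg invgM.
have -> : (z ^ y = z)%g by apply/conjg_fixP/commgP/K2_central.
rewrite -mulgA (mulgA x'^-1%g) -[(_ * z)%g](K2_central _ zK).
by rewrite mulKg.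
Qed.

Lemma comm_act x x' y y' : St_act x = St_act x' -> St_act y = St_act y' ->
  [~ x, y]%g = [~ x', y']%g.
Proof.
by move=> /comm_act_l-> yy'; rewrite -invgR (comm_act_l _ yy') invgR.
Qed.

(* Matrices determine elements of St(R) only up to the center, but commutators
   exactly; x_ij(ab) = [x_im(a), x_mj(b)] thus lifts conjugation relations from
   GL(R) to St(R). *)
Lemma sx_conj_act g i m j i' m' j' a b a' b' :
  i != m -> m != j -> i != j -> i' != m' -> m' != j' -> i' != j' ->
  St_act (g * sx i m a)%g = St_act (sx i' m' a' * g)%g ->
  St_act (g * sx m j b)%g = St_act (sx m' j' b' * g)%g ->
  (g * sx i j (a * b) = sx i' j' (a' * b') * g)%g.
Proof.
move=> im mj ij im' mj' ij' ga gb.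
have conjE s s' : St_act (g * s)%g = St_act (s' * g)%g ->
    St_act (s^-1 ^ g^-1)%g = St_act s'^-1%g.
  move=> ss'; rewrite conjVg; apply: St_actV_eq.
  by rewrite conjgE invgK mulgA !St_actM -St_actM ss' St_actM -compA St_actKV.
suff <- : (sx i j (a * b) ^ g^-1 = sx i' j' (a' * b'))%g.
  by rewrite conjgE invgK mulgA mulgVK.
rewrite -(sx_comm _ _ im mj ij) -(sx_comm _ _ im' mj' ij') conjRg !sxN.
by apply: comm_act; apply: conjE.
Qed.

Definition is_diag g d d' :=
  (forall v, St_act g v = fun k => d k * v k) /\ forall k, d k * d' k = 1.

Lemma third_index i j : exists2 m, i != m & m != j.
Proof.
exists (i + j).+1; first by rewrite ltn_eqF // ltnS leq_addr.
by rewrite gtn_eqF // ltnS leq_addl.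
Qed.

Lemma is_diag_sx g d d' i j a : is_diag g d d' ->
  (g * sx i j a = sx i j (d i * a * d' j) * g)%g.
Proof.
move=> [gd dd']; have [->|ij] := eqVneq i j; first by rewrite !sx_diag mulg1 mul1g.
have [m im mj] := third_index i j.
have -> : d i * a * d' j = (d i * a * d' m) * (d m * 1 * d' j).
  have dm := dd' m; by ring: dm.
rewrite -[in LHS](mulr1 a); apply: (sx_conj_act (m := m) (m' := m)) => //.
  rewrite !St_actM !St_act_sx //; apply/funext => v /=; rewrite !gd.
  apply/funext => k; rewrite /elem_act; case: eqP => // ->.
  have dm := dd' m; by ring: dm.
rewrite !St_actM !St_act_sx //; apply/funext => v /=; rewrite !gd.
apply/funext => k; rewrite /elem_act; case: eqP => // ->.
have dj := dd' j; by ring: dj.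
Qed.

Lemma is_diagM g d d' h e e' : is_diag g d d' -> is_diag h e e' ->
  is_diag (g * h)%g (fun k => d k * e k) (fun k => d' k * e' k).
Proof.
move=> [gd dd'] [he ee']; split=> [v|k]; last by rewrite mulrACA dd' ee' mulr1.
by rewrite St_actM /= he gd; apply/funext => k; rewrite mulrA.
Qed.

Lemma is_diagV g d d' : is_diag g d d' -> is_diag g^-1%g d' d.
Proof.
move=> [gd dd']; split=> [v|k]; last by rewrite mulrC.
have {1}<- : St_act g (fun k => d' k * v k) = v.
  by rewrite gd; apply/funext => k; rewrite mulrA dd' mul1r.
exact: (congr1 (fun f : (nat -> R) -> nat -> R => f (fun k => d' k * v k)) (St_actVK g)).
Qed.

(** Milnor's w_ij(1), locked so that rewriting with the lemmas on [sx] does not reach inside. *)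
Fact weyl_key : unit. Proof. exact: tt. Qed.
Definition weyl i j : St R := locked_with weyl_key
  (sx i j 1 * sx j i (- 1) * sx i j 1)%g.

Lemma weylE i j : weyl i j = (sx i j 1 * sx j i (- 1) * sx i j 1)%g.
Proof. by rewrite /weyl unlock. Qed.

Lemma act_weyl i j v : i != j -> St_act (weyl i j) v =
  fun k => if k == i then v j else if k == j then - v i else v k.
Proof.
move=> ij; have ji : j != i by rewrite eq_sym.
rewrite weylE !St_actM !St_act_sx // /elem_act /=; apply/funext => k.
rewrite !eqxx ?(negPf ij) ?(negPf ji).
by case: eqP => [->|_]; rewrite ?(negPf ij); last (case: eqP => [->|//]); ring.
Qed.

Lemma weyl_sx i j a : i != j -> (weyl i j * sx i j a = sx j i (- a) * weyl i j)%g.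
Proof.
move=> ij; have ji : j != i by rewrite eq_sym.
have [m im mj] := third_index i j; rewrite -[in LHS](mulr1 a) -[- a]mulr1.
have [mi jm] : m != i /\ j != m by rewrite eq_sym im eq_sym.
apply: (sx_conj_act (m := m) (m' := m)) => //;
  rewrite [LHS]St_actM [RHS]St_actM !St_act_sx //; apply/funext => v /=;
  rewrite !act_weyl // /elem_act; apply/funext => k.
  rewrite ?eqxx ?(negPf mi) ?(negPf mj) ?(negPf im) ?(negPf jm) ?(negPf ij) ?(negPf ji).
  by case: (eqVneq k i) => [->|_]; rewrite ?(negPf ij) //; case: eqP => // _; ring.
rewrite ?eqxx ?(negPf mi) ?(negPf mj) ?(negPf im) ?(negPf jm) ?(negPf ij) ?(negPf ji).
case: (eqVneq k i) => [->|_]; first by rewrite ?(negPf im) ?(negPf jm).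
by case: (eqVneq k j) => [->|//]; rewrite ?(negPf jm).
Qed.

Lemma weyl_sx' i j a : i != j -> (weyl i j * sx j i a = sx i j (- a) * weyl i j)%g.
Proof.
move=> ij; have ji : j != i by rewrite eq_sym.
have [m im mj] := third_index i j; rewrite -[in LHS](mulr1 a) -mulrN1.
have [mi jm] : m != i /\ j != m by rewrite eq_sym im eq_sym.
apply: (sx_conj_act (m := m) (m' := m)) => //;
  rewrite [LHS]St_actM [RHS]St_actM !St_act_sx //; apply/funext => v /=;
  rewrite !act_weyl // /elem_act; apply/funext => k.
  rewrite ?eqxx ?(negPf mi) ?(negPf mj) ?(negPf im) ?(negPf jm) ?(negPf ij) ?(negPf ji).
  case: (eqVneq k i) => _; first by rewrite ?eqxx ?(negPf jm).
  by case: (eqVneq k j).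
rewrite ?eqxx ?(negPf mi) ?(negPf mj) ?(negPf im) ?(negPf jm) ?(negPf ij) ?(negPf ji).
case: (eqVneq k i) => [->|_]; first by rewrite ?(negPf im) ?(negPf jm).
case: (eqVneq k j) => [->|_]; first by rewrite ?(negPf jm).
by case: eqP => // _; ring.
Qed.

End Lifts.

(** * Torus elements and Dennis-Stein symbols *)

Section Torus.
Variable R : comPzRingType.
Implicit Types (i j k m : nat) (a b c u : R) (v d : nat -> R) (x y z g h t : St R).

Definition diag2 i j u u' : nat -> R :=
  fun k => if k == i then u else if k == j then u' else 1.

Lemma unit_lift i j u u' : i != j -> u * u' = 1 ->
  exists g, is_diag g (diag2 i j u u') (diag2 i j u' u).
Proof.
move=> ij uu'; have ji : j != i by rewrite eq_sym.
(* Milnor's h_ij(u) = w_ij(u) w_ij(-1). *)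
exists (sx i j u * sx j i (- u') * sx i j u * (sx i j (- 1) * sx j i 1 * sx i j (- 1)))%g.
split=> [v|k]; last first.
  by rewrite /diag2; case: eqP => // _; case: eqP => // _; rewrite ?mulr1 // mulrC.
rewrite !St_actM !St_act_sx //; apply/funext => k; rewrite /elem_act /diag2 /=.
rewrite !eqxx ?(negPf ij) ?(negPf ji).
case: (eqVneq k i) => [->|_]; first by rewrite ?(negPf ij); ring: uu'.
by case: (eqVneq k j) => [->|_]; ring: uu'.
Qed.

(* The torus element with x_ij(a) x_ji(b) in x_ji(R) tor x_ij(R); it is meant
   for (ab)^2 = 0, when 1 - ab inverts 1 + ab. *)
Fact tor_key : unit. Proof. exact: tt. Qed.
Definition tor i j a b : St R := locked_with tor_key
  (sx j i (- (b * (1 - a * b))) * sx i j a * sx j i b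
     * sx i j (- (a * (1 - a * b))))%g.

Lemma torE i j a b : tor i j a b =
  (sx j i (- (b * (1 - a * b))) * sx i j a * sx j i b
     * sx i j (- (a * (1 - a * b))))%g.
Proof. by rewrite /tor unlock. Qed.

Lemma sx_tor i j a b :
  (sx i j a * sx j i b =
     sx j i (b * (1 - a * b)) * tor i j a b * sx i j (a * (1 - a * b)))%g.
Proof. by rewrite torE !sxN -!mulgA mulVg mulg1 mulVKg. Qed.

Lemma tor_diag i j a b : i != j -> a * b * (a * b) = 0 ->
  is_diag (tor i j a b) (diag2 i j (1 + a * b) (1 - a * b))
                        (diag2 i j (1 - a * b) (1 + a * b)).
Proof.
move=> ij ab0; have ji : j != i by rewrite eq_sym.
split=> [v|k]; last first.
  by rewrite /diag2; case: eqP => _; [|case: eqP => _]; ring: ab0.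
rewrite torE !St_actM !St_act_sx //; apply/funext => k; rewrite /elem_act /diag2 /=.
rewrite !eqxx ?(negPf ij) ?(negPf ji).
case: (eqVneq k i) => [->|_]; first by rewrite ?(negPf ij); ring: ab0.
by case: (eqVneq k j) => [->|_]; ring: ab0.
Qed.

(** In this case [tor i j a b] is the Dennis-Stein symbol <a, b> itself. *)
Lemma tor_K2 i j a b : i != j -> a * b = 0 -> tor i j a b \in @K2_pred R.
Proof.
move=> ij ab0; apply/K2P/funext => v; have [|-> _] := @tor_diag i j a b ij.
  by rewrite ab0 mulr0.
apply/funext => k; rewrite ab0 addr0 subr0 /diag2.
by case: eqP => _; [|case: eqP => _]; rewrite mul1r.
Qed.

Lemma is_diag_tor g d d' i j a b : is_diag g d d' ->
  (g * tor i j a b = tor i j (d i * a * d' j) (d j * b * d' i) * g)%g.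
Proof.
move=> gd; have [_ dd'] := gd.
rewrite !torE !mulgA (is_diag_sx j i _ gd) -!mulgA; congr (_ * _)%g.
  by congr sx; have di := dd' i; have dj := dd' j; ring: di dj.
rewrite mulgA (is_diag_sx i j _ gd) -!mulgA; congr (_ * _)%g.
rewrite mulgA (is_diag_sx j i _ gd) -!mulgA; congr (_ * _)%g.
rewrite (is_diag_sx i j _ gd); congr (sx _ _ _ * _)%g.
by have di := dd' i; have dj := dd' j; ring: di dj.
Qed.

(** Moving x_ji(b) left past x_ij(a) and then x_ij(a') must agree with moving it past x_ij(a + a').
    As b^2 = 0, it emerges unchanged from each pass, and cancelling the root factors compares the
    torus factors. *)
Lemma tor_addl i j a a' b : i != j -> b * b = 0 ->
  (tor i j (a + a') b = tor i j a' b * tor i j a b)%g.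
Proof.
move=> ij b0; have ji : j != i by rewrite eq_sym.
have tD : is_diag (tor i j a b) (diag2 i j (1 + a * b) (1 - a * b))
   (diag2 i j (1 - a * b) (1 + a * b)) by apply: tor_diag => //; ring: b0.
have bE c : b * (1 - c * b) = b by ring: b0.
have E := sx_tor i j (a + a') b; rewrite bE in E.
apply: (mulgI (sx j i b)); apply: (mulIg (sx i j ((a + a') * (1 - (a + a') * b)))).
rewrite -E [a + a']addrC sxD -[LHS]mulgA [X in (_ * X)%g]sx_tor bE !mulgA.
rewrite sx_tor bE -!mulgA; congr (_ * (_ * _))%g.
rewrite !mulgA; have -> : a' * (1 - a' * b) =
    (1 + a * b) * ((1 - a * b) * (a' * (1 - a' * b)) * (1 - a * b)) * (1 + a * b).
  by ring: b0.
have := is_diag_sx i j ((1 - a * b) * (a' * (1 - a' * b)) * (1 - a * b)) tD.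
rewrite /diag2 eqxx (negPf ji) eqxx => <-.
rewrite -mulgA -sxD; congr (_ * sx _ _ _)%g; ring: b0.
Qed.

Lemma tor0l i j b : i != j -> b * b = 0 -> tor i j 0 b = 1%g.
Proof.
by move=> ij b0; apply: (mulgI (tor i j 0 b)); rewrite -tor_addl // addr0 mulg1.
Qed.

Lemma tor0r i j a : tor i j a 0 = 1%g.
Proof. by rewrite torE mulr0 subr0 !mulr1 oppr0 !sx0 mul1g mulg1 -sxD subrr sx0. Qed.

(** Mirror image of [tor_addl]: x_ij(a) moves right past x_ji(b) and then x_ji(b'), and the first
    pass turns a into a(1 - ab). *)
Lemma tor_addr i j a b b' : i != j -> b * b = 0 -> b' * b' = 0 -> b * b' = 0 ->
  (tor i j a (b + b') = tor i j a b * tor i j (a * (1 - a * b)) b')%g.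
Proof.
move=> ij b0 b0' bb'; have ji : j != i by rewrite eq_sym.
have tD : is_diag (tor i j a b) (diag2 i j (1 + a * b) (1 - a * b))
   (diag2 i j (1 - a * b) (1 + a * b)) by apply: tor_diag => //; ring: b0.
have bE c : (b + b') * (1 - c * (b + b')) = b + b' by ring: b0 b0' bb'.
have bE1 c : b * (1 - c * b) = b by ring: b0.
have bE2 c : b' * (1 - c * b') = b' by ring: b0'.
have E := sx_tor i j a (b + b'); rewrite bE in E.
apply: (mulgI (sx j i (b + b'))); apply: (mulIg (sx i j (a * (1 - a * (b + b'))))).
rewrite -E !sxD mulgA sx_tor bE1 -[LHS]mulgA [X in (_ * X)%g]sx_tor bE2 -!mulgA.
congr (_ * _)%g; have := is_diag_sx j i b' tD.
rewrite /diag2 eqxx (negPf ji) eqxx.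
have -> : (1 - a * b) * b' * (1 - a * b) = b' by ring: bb'.
rewrite !mulgA => ->; congr (_ * _ * _ * sx _ _ _)%g; ring: bb' b0.
Qed.

Lemma torV i j a b : ((tor i j a b)^-1 = tor j i (- b) (- a))%g.
Proof.
rewrite !torE !invgM -!sxN !mulgA !opprK.
by congr (sx _ _ _ * sx _ _ _ * sx _ _ _ * sx _ _ _)%g; ring.
Qed.

Lemma weyl_tor i j a b : i != j ->
  (weyl R i j * tor j i a b = tor i j (- a) (- b) * weyl R i j)%g.
Proof.
move=> ij; rewrite !torE !mulgA weyl_sx // -!mulgA; congr (_ * _)%g.
  by congr sx; ring.
rewrite mulgA weyl_sx' // -!mulgA; congr (_ * _)%g.
rewrite mulgA weyl_sx // -!mulgA; congr (_ * _)%g.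
by rewrite weyl_sx' //; congr (sx _ _ _ * _)%g; ring.
Qed.

Lemma weyl_torV i j a b : i != j ->
  (weyl R i j * (tor i j a b)^-1 = tor i j b a * weyl R i j)%g.
Proof. by move=> ij; rewrite torV weyl_tor // !opprK. Qed.

(** Weyl conjugation carries the inverse of the symbol to the swapped symbol, but a central element
    is fixed by it. *)
Lemma tor_swapV i j a b : i != j -> a * b = 0 ->
  (tor i j b a = (tor i j a b)^-1)%g.
Proof.
move=> ij ab0; apply: (mulIg (weyl R i j)); rewrite -weyl_torV //.
apply/commuteV/commute_sym/K2_central/tor_K2 => //.
Qed.

(** Conjugation by a diagonal lift with u at i and u' at an outside index m scales the arguments by
    u and u', and it fixes the central symbol. *)
Lemma tor_unit i j a b u u' : i != j -> u * u' = 1 -> a * b = 0 ->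
  tor i j (u * a) (u' * b) = tor i j a b.
Proof.
move=> ij uu' ab0; have [m im mj] := third_index i j.
have [g gD] := unit_lift im uu'; have := is_diag_tor i j a b gD.
have jm : j == m = false by rewrite eq_sym (negPf mj).
have ji : j == i = false by rewrite eq_sym (negPf ij).
rewrite /diag2 eqxx ji jm mulr1 mul1r [b * u']mulrC => /esym E.
by apply: (mulIg g); rewrite E; apply/commute_sym/K2_central/tor_K2.
Qed.

End Torus.

(** * Functoriality of the Steinberg group *)

Section Functor.
Variables (A B : comPzRingType) (f : {rmorphism A -> B}).
Implicit Types (x y : St A).

Definition letter_map (l : stgen A * bool) : stgen B * bool :=
  let: (exist g ij, e) := l in (exist _ (g.1, f g.2) ij, e).

Definition word_map (w : gword (stgen A)) : gword (stgen B) := map letter_map w.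

Definition St_map x : St B := presclass (@steinberg_rel B) (word_map (repr x)).

Lemma word_map_eq u w : pres_eq (@steinberg_rel A) u w ->
  pres_eq (@steinberg_rel B) (word_map u) (word_map w).
Proof.
elim=> {u w} [u|u w _|u w z _ + _|u u' w w' _ + _|[[[i j] b] ij] e|u w].
- exact: PresRefl.
- exact: PresSym.
- exact: PresTrans.
- by rewrite /word_map !map_cat; apply: PresCat.
- exact: PresCancel.
case=> {u w} [i j ij a b|i j k ij jk ik a b|i j k m ij km a b jk im]; apply: PresRel.
- by have := StAdd ij (f a) (f b); rewrite -rmorphD.
- by have := StComm ij jk ik (f a) (f b); rewrite -rmorphM.
- exact: StComm1 ij km (f a) (f b) jk im.
Qed.

Lemma St_map_class (w : gword (stgen A)) :
  St_map (presclass (@steinberg_rel A) w) = presclass (@steinberg_rel B) (word_map w).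
Proof. exact/presclassP/word_map_eq/pres_eq_repr. Qed.

Lemma St_map1 : St_map 1%g = 1%g.
Proof. exact: St_map_class [::]. Qed.

Lemma St_mapM x y : St_map (x * y)%g = (St_map x * St_map y)%g.
Proof.
by rewrite St_map_class /word_map map_cat St_classM.
Qed.

Lemma St_mapV x : St_map x^-1%g = (St_map x)^-1%g.
Proof. by apply/esym/mulg1_eq; rewrite -St_mapM mulgV St_map1. Qed.

Lemma St_map_sx i j a : St_map (sx i j a) = sx i j (f a).
Proof.
have [->|ij] := eqVneq i j; first by rewrite !sx_diag St_map1.
by rewrite !(sxE ij) St_map_class.
Qed.

Lemma act_St_map x v : St_act (St_map x) (f \o v) = f \o St_act x v.
Proof.
elim/St_ind: x v => [v|i j a x ij IHx v]; first by rewrite St_map1 !St_act1.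
rewrite St_mapM St_map_sx !St_actM /= IHx !St_act_sx //.
apply/funext => k; rewrite /elem_act /=.
by case: ifP => _; rewrite ?rmorphD ?rmorphM.
Qed.

Lemma St_map_surj : (forall b, exists a, f a = b) -> 
  forall y : St B, exists x, St_map x = y.
Proof.
move=> fS; elim/St_ind => [|i j b y ij [x <-]]; first by exists 1%g; rewrite St_map1.
by have [a <-] := fS b; exists (sx i j a * x)%g; rewrite St_mapM St_map_sx.
Qed.

End Functor.

(** * Determinants and matrix entries of the action *)

Lemma St_class_letter (R : comPzRingType) i j (a : R) (ij : i != j) b :
  presclass (@steinberg_rel R) [:: (exist _ (i, j, a) ij, b)] = sx i j ((-1) ^+ b * a).
Proof.
case: b; rewrite ?expr0 ?expr1 ?mul1r ?mulN1r ?sxN (sxE ij) //.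
by rewrite -St_classV.
Qed.

Lemma det_word_mx (R : comPzRingType) N (w : gword (stgen R)) : \det (word_mx N w) = 1.
Proof.
apply: (big_ind (fun A : 'M[R]_N => \det A = 1)) => [|A C dA dC|[[[[i j] a] ij] b] _].
- exact: det1.
- by rewrite det_mulmx dA dC mulr1.
rewrite /elem_mx /=; set c := _ * a.
have diag1 (A : 'M[R]_N) : is_trig_mx A -> (forall r, A r r = 1) -> \det A = 1.
  by move=> /det_trig-> A1; rewrite big1.
have entry1 r : (1%:M + entry_mx N i j c) r r = 1.
  rewrite !mxE eqxx; case: ifP => [/andP[/eqP ri /eqP rj]|_]; last by rewrite addr0.
  by move: ij; rewrite -ri -rj eqxx.
have [ltij|leji] := ltnP i j; last first.
  apply: diag1 => //; apply/is_trig_mxP => r s rs; rewrite !mxE -val_eqE /= ltn_eqF //.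
  case: ifP => [/andP[/eqP ri /eqP sj]|_]; last by rewrite addr0.
  by move: rs; rewrite ri sj ltnNge leji.
rewrite -det_tr; apply: diag1 => [|r]; last by rewrite mxE entry1.
apply/is_trig_mxP => r s rs; rewrite !mxE -val_eqE /= gtn_eqF //.
case: ifP => [/andP[/eqP si /eqP rj]|_]; last by rewrite addr0.
by move: rs; rewrite si rj ltnNge (ltnW ltij).
Qed.

Lemma word_mx_act (R : comPzRingType) N (w : gword (stgen R)) (i j : 'I_N) :
  (word_bound w <= N)%N -> word_mx N w i j = word_act w (basis_vec R j) i.
Proof.
move=> wN; rewrite word_act_mx // (bigD1 j) //= /basis_vec eqxx mulr1.
by rewrite big1 ?addr0 // => k /negPf kj; rewrite val_eqE kj mulr0.
Qed.

Lemma St_act_bound (R : comPzRingType) (x : St R) : exists2 M, (0 < M)%N &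
  (forall v k, (M <= k)%N -> St_act x v k = v k) /\
  (forall v k, (k < M)%N ->
     St_act x v k = \sum_(j <- iota 0 M) St_act x (basis_vec R j) k * v j).
Proof.
exists (word_bound (repr x)).+1 => //; split=> v k kM.
  by apply: word_act_out (ltnW kM).
rewrite -[in iota _ _](subn0 _.+1) -/(index_iota _ _) big_mkord.
rewrite -[k]/(val (Ordinal kM)) [LHS]word_act_mx ?leqnSn //.
by apply: eq_bigr => j _; rewrite word_mx_act.
Qed.

(** The action is that of diag(1 + t, 1, ..., 1), whereas a product of elementary matrices has
    determinant 1. *)
Lemma St_act_det (R : comPzRingType) (x : St R) (t : R) :
  (forall v k, St_act x v k = v k + (if k == 0%N then t * v 0%N else 0)) -> t = 0.
Proof.
move=> xt; pose N := (word_bound (repr x)).+1.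
have := det_word_mx N (repr x).
have -> : word_mx N (repr x) = diag_mx (\row_(i < N) (1 + (if i == 0 then t else 0))).
  apply/matrixP => i j; rewrite word_mx_act ?leqnSn // -/(St_act x) xt !mxE /basis_vec.
  rewrite -!val_eqE /= eq_sym; case: eqP => [->|ij].
    by rewrite mulr1n; congr (_ + _); case: eqP => // ->; rewrite mulr1.
  rewrite mulr0n add0r; case: eqP => // i0; case: eqP; rewrite ?mulr0 // => j0.
  by case: ij; rewrite i0 -j0.
rewrite det_diag (bigD1 ord0) //= mxE eqxx big1 => [|i /negPf i0]; last first.
  by rewrite mxE i0 addr0.
by rewrite mulr1 => /(canRL (addKr _)) ->; rewrite addNr.
Qed.

(** * Vanishing of the Steinberg symbols {u, 1 + b} *)

Section SymbolVanishing.
Variable R : comPzRingType.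
Implicit Types (i j m n : nat) (a b c u : R) (g s t z : St R).

Lemma is_diagX g d d' n : is_diag g d d' ->
  is_diag (g ^+ n)%g (fun k => d k ^+ n) (fun k => d' k ^+ n).
Proof.
move=> gD; elim: n => [|n IHn].
  by split=> [v|k]; rewrite ?St_act1 ?mulr1 //; apply/funext => k; rewrite mul1r.
have [gd gd'] := is_diagM gD IHn; rewrite expgS.
split=> [v|k]; last by rewrite !exprS gd'.
by rewrite gd; apply/funext => k; rewrite exprS.
Qed.

(* Commutators of lifts of commuting matrices are central and bimultiplicative,
   so [g, s^p] = [g^p, s]. *)
Lemma commute_root g s p : (0 < p)%N ->
  [~ g, s]%g \in @K2_pred R -> (g ^+ p)%g \in @K2_pred R ->
  commute g (s ^+ p)%g.
Proof.
move=> p0 zK gK; set z := [~ g, s]%g in zK.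
have gs : (g * s = s * g * z)%g by rewrite commgC.
have zC y : (z * y = y * z)%g by apply: K2_central.
have znC n y : (z ^+ n * y = y * z ^+ n)%g.
  by apply/commute_sym/commuteX/commute_sym/zC.
have gnC n : (g ^+ n * s = s * g ^+ n * z ^+ n)%g.
  elim: n => [|n IHn]; first by rewrite !mulg1 mul1g.
  by rewrite !expgSr -[LHS]mulgA gs !mulgA IHn -(mulgA _ (z ^+ n)%g g) znC !mulgA.
have snC n : (g * s ^+ n = s ^+ n * g * z ^+ n)%g.
  elim: n => [|n IHn]; first by rewrite !mulg1 mul1g.
  by rewrite expgS mulgA gs -mulgA zC mulgA -(mulgA s) IHn !mulgA expgSr !mulgA.
have zp : (z ^+ p = 1)%g.
  apply: (mulgI (s * g ^+ p)%g); rewrite -gnC mulg1; exact: K2_central.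
by rewrite /commute snC zp mulg1.
Qed.

(** The commutator of g and t is Milnor's form of the symbol {u, c^p}, which equals {u^p, c} = 1.
    The power s^p of a lift of c need only act like t, by [comm_act]. *)
Lemma symbol_root i j m u u' c c' p g t : (0 < p)%N ->
  i != j -> i != m -> j != m -> u ^+ p = 1 -> c * c' = 1 ->
  is_diag g (diag2 i m u u') (diag2 i m u' u) ->
  is_diag t (diag2 i j (c ^+ p) (c' ^+ p)) (diag2 i j (c' ^+ p) (c ^+ p)) ->
  commute g t.
Proof.
move=> p0 ij im jm up cc' gD tD; have [s sD] := unit_lift ij cc'.
have uu' : u * u' = 1 by have [_ /(_ i)] := gD; rewrite /diag2 eqxx.
have u'p : u' ^+ p = 1 by rewrite -[LHS]mul1r -up -exprMn uu' expr1n.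
have sp : St_act (s ^+ p)%g = St_act t.
  have [sd _] := is_diagX p sD; have [td _] := tD.
  apply/funext => v; rewrite sd td; apply/funext => k; rewrite /diag2.
  by case: eqP => // _; case: eqP => // _; rewrite expr1n.
apply/commgP/eqP; rewrite -(comm_act (erefl (St_act g)) sp); apply/eqP/commgP.
have [gd gd'] := gD; have [sd sd'] := sD.
apply: commute_root => //; apply/K2P/funext => v.
  rewrite commgEl conjgE; have [E _] := is_diagM (is_diagV gD)
     (is_diagM (is_diagV sD) (is_diagM gD sD)).
  rewrite E; apply/funext => k; have e1 := gd' k; have e2 := sd' k.
  by rewrite /=; ring: e1 e2.
have [-> _] := is_diagX p gD; apply/funext => k; rewrite /diag2.
by case: eqP => _; [rewrite up mul1r | case: eqP => _; rewrite ?u'p ?expr1n mul1r].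
Qed.

(* In Dennis-Stein notation, with x = 1 + u: <x, 2x> = 2 <x, x> = 0 by
   antisymmetry.  If u generates G of order 2 and R = (Z/4)[G], then 1 + 2x is
   not a square, so symbol_root does not apply. *)
Lemma symbol_order2 i j m u u' g t : i != j -> i != m -> j != m ->
  u * u = 1 -> 1 + 1 + (1 + 1) = 0 :> R ->
  is_diag g (diag2 i m u u') (diag2 i m u' u) ->
  is_diag t (diag2 i j (1 + (1 + u + (1 + u))) (1 - (1 + u + (1 + u))))
            (diag2 i j (1 - (1 + u + (1 + u))) (1 + (1 + u + (1 + u)))) ->
  commute g t.
Proof.
move=> ij im jm uu four gD tD; have ji : j != i by rewrite eq_sym.
have uu' : u * u' = 1 by have [_ /(_ i)] := gD; rewrite /diag2 eqxx.
have u'E : u' = u by rewrite -[LHS]mul1r -uu -mulrA uu' mulr1.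
rewrite u'E in gD.
pose x := 1 + u; pose b := x + x; rewrite -/x -/b in tD.
have xx : x * x = b by rewrite /b /x; ring: uu.
have bb0 : b + b = 0.
  have -> : b + b = (1 + 1 + (1 + 1)) * x by rewrite /b; ring.
  by rewrite four mul0r.
have xb : x * b = 0 by rewrite /b mulrDr xx.
have b0 : b * b = 0 by rewrite {1}/b mulrDl xb addr0.
have ub : u * b = b by rewrite /b /x; ring: uu.
have bN : - b = b by apply/esym/eqP; rewrite -subr_eq0 opprK bb0.
pose T := tor i j x x.
have TD : is_diag T (diag2 i j (1 + b) (1 - b)) (diag2 i j (1 - b) (1 + b)).
  by rewrite -xx; apply: tor_diag => //; rewrite xx.
have TX : commute T (sx i j 1).
  rewrite /commute (is_diag_sx i j 1 TD) /diag2 !eqxx (negPf ji).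
  by congr (sx _ _ _ * _)%g; ring: b0 bb0.
have TY c : (1 - b) * c * (1 - b) = c -> commute T (sx j i c).
  by move=> E; rewrite /commute (is_diag_sx j i c TD) /diag2 !eqxx (negPf ji) E.
have b2 c : (1 - b) * c * (1 - b) = c - (b + b) * c by ring: b0.
have Tw : commute T (weyl R i j).
  rewrite weylE; apply: commuteM => //; apply: commuteM => //.
  by apply: TY; rewrite b2 bb0 mul0r subr0.
(* Conjugation by the Weyl element inverts T ([weyl_torV]) but also fixes it ([Tw]). *)
have TT : (T * T = 1)%g.
  have := weyl_torV x x ij; rewrite -/T => E.
  have {}E : (T * weyl R i j = T^-1 * weyl R i j)%g.
    by rewrite -E; apply/commuteV/commute_sym.
  by rewrite {2}(mulIg _ _ _ E) mulgV.
(* Both sides come from moving x_ij(x) past x_ji(x) x_ji(x), at once or in two passes; T commutes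
   with x_ji(x) because 2b = 0. *)
have xbE : tor i j x b = (T * T)%g.
  have E1 : (sx i j x * sx j i x = sx j i x * T * sx i j x)%g.
    by rewrite sx_tor; congr (sx _ _ _ * _ * sx _ _ _)%g; rewrite xx mulrBr mulr1 xb subr0.
  have E2 : (sx i j x * sx j i b = sx j i b * tor i j x b * sx i j x)%g.
    by rewrite sx_tor xb subr0 !mulr1.
  apply: (mulgI (sx j i b)); apply: (mulIg (sx i j x)); rewrite -E2 /b !(sxD j i x x).
  rewrite mulgA E1 -[LHS]mulgA E1 !mulgA; congr (_ * _ * _)%g; rewrite -!mulgA.
  by congr (_ * _)%g; apply: TY; rewrite b2 bb0 mul0r subr0.
rewrite TT in xbE.
have tt1 : (tor i j 1 b * tor i j 1 b = 1)%g.
  have := @tor_addr _ i j 1 b b ij b0 b0 b0; rewrite bb0 tor0r !mul1r bN => ->.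
  rewrite (tor_addl 1 b ij b0) {3}/b (tor_addl x x ij b0) xbE mulg1 mul1g //.
(* By [tor_addl] the product of the two sides is [tor i j x b], which is trivial, and [tt1] makes
   the right side its own inverse. *)
have tu : tor i j u b = tor i j 1 b.
  apply: (mulIg (tor i j 1 b)); rewrite tt1 -tor_addl //.
have tT : St_act t = St_act (tor i j 1 b).
  have := tor_diag ij (a := 1) (b := b); rewrite mul1r => /(_ b0) [Td _].
  by have [td _] := tD; apply/funext => v; rewrite td Td.
apply/commgP/eqP; rewrite (comm_act (erefl (St_act g)) tT); apply/eqP/commgP.
rewrite /commute (is_diag_tor i j 1 b gD) /diag2 eqxx [j == i]eq_sym (negPf ij) (negPf jm).
by rewrite !mulr1 mul1r mulrC ub tu.
Qed.

End SymbolVanishing.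

(** * Square-zero ideals *)

Section SquareZero.
Variables (R : comPzRingType) (I S : R -> Prop).
Implicit Types (i j k m : nat) (a b c u : R) (x y z g h t : St R).

Hypothesis I0 : I 0.
Hypothesis ID : forall b b', I b -> I b' -> I (b + b').
Hypothesis IM : forall a b, I b -> I (a * b).
Hypothesis I_sq : forall b b', I b -> I b' -> b * b' = 0.
(** The half b0 need not lie in I: for p = 2 and b = 2^k y it will be 2^(k-1) y. *)
Hypothesis I_half : forall b, I b ->
  exists2 b0, b = b0 + b0 & forall b', I b' -> b0 * b' = 0.
Hypothesis S_unit : forall u, S u -> exists u', u * u' = 1.
Hypothesis S_gen : forall P : R -> Prop, P 0 ->
  (forall a u, S u -> P a -> P (a + u)) -> forall a, P a.
Hypothesis S_symbol : forall u u' b i j m g t, S u -> u * u' = 1 -> I b ->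
  i != j -> i != m -> j != m ->
  is_diag g (diag2 i m u u') (diag2 i m u' u) ->
  is_diag t (diag2 i j (1 + b) (1 - b)) (diag2 i j (1 - b) (1 + b)) ->
  commute g t.

Lemma IN b : I b -> I (- b).
Proof. by move=> Ib; rewrite -mulN1r; apply: IM. Qed.

(** The error terms tolerated until [tor_I1] removes them by halving. *)
Definition involutive_K2 x := x \in @K2_pred R /\ (x * x = 1)%g.

Lemma involutive_K2M x y :
  involutive_K2 x -> involutive_K2 y -> involutive_K2 (x * y)%g.
Proof.
move=> [xK x2] [yK y2]; split.
  by apply/K2P; rewrite St_actM (K2P _).1 // (K2P _).1.
by rewrite {2}(K2_central y xK : (x * y = y * x)%g) mulgA -(mulgA x) y2 mulg1.
Qed.

Lemma involutive_K21 : involutive_K2 1%g.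
Proof. by split; rewrite ?mulg1 //; apply/K2P/St_act1. Qed.

Lemma tor_one_diag i j b : i != j -> I b ->
  is_diag (tor i j 1 b) (diag2 i j (1 + b) (1 - b)) (diag2 i j (1 - b) (1 + b)).
Proof.
by move=> ij Ib; have := @tor_diag _ i j 1 b ij; rewrite mul1r; apply; apply: I_sq.
Qed.

(** Conjugation by a diagonal lift of u turns the right side into the left one, and [S_symbol] says
    that it changes nothing. *)
Lemma tor_S i j u b : i != j -> S u -> I b -> tor i j u b = tor i j 1 (u * b).
Proof.
move=> ij Su Ib; have [u' uu'] := S_unit Su; have [m im mj] := third_index i j.
have jm : j != m by rewrite eq_sym.
have [g gD] := unit_lift im uu'; have := is_diag_tor i j 1 (u * b) gD.
rewrite /diag2 eqxx [j == i]eq_sym (negPf ij) (negPf jm) !mulr1 mul1r.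
have -> : u * b * u' = b by ring: uu'.
rewrite (S_symbol Su uu' (IM u Ib) ij im jm gD (tor_one_diag ij (IM u Ib))).
by move=> /mulIg.
Qed.

(** By additivity in a it suffices to treat <ub, b>; it equals <b, ub> by [tor_unit], which is its
    inverse by [tor_swapV]. *)
Lemma tor_sq_mull i j a b : i != j -> I b -> involutive_K2 (tor i j (a * b) b).
Proof.
move=> ij Ib; have b0 := I_sq Ib Ib; elim/S_gen: a => [|a u Su IHa].
  by rewrite mul0r tor0l //; apply: involutive_K21.
rewrite mulrDl tor_addl //; apply: involutive_K2M => //.
have [u' uu'] := S_unit Su.
have E : tor i j (u * b) b = tor i j b (u * b).
  rewrite -[RHS](tor_unit (u := u) (u' := u')) //; last by ring: b0.
  by congr tor; ring: uu'.
split; first by apply: tor_K2; rewrite // -mulrA b0 mulr0.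
by rewrite {1}E (tor_swapV (a := u * b)) ?mulVg // -mulrA b0 mulr0.
Qed.

Lemma tor_sq_mul2 i j a a' b : i != j -> I b ->
  involutive_K2 (tor i j (a * b) (a' * b)).
Proof.
move=> ij Ib; have b0 := I_sq Ib Ib; elim/S_gen: a' => [|a' u Su IHa].
  by rewrite mul0r tor0r //; apply: involutive_K21.
rewrite mulrDl tor_addr //; try by ring: b0.
apply: involutive_K2M => //; have [u' uu'] := S_unit Su.
have -> : a * b * (1 - a * b * (a' * b)) = a * b by ring: b0.
rewrite -(tor_unit (u := u) (u' := u')) //; last by ring: b0.
have -> : u' * (u * b) = b by ring: uu'.
by rewrite mulrA; apply: tor_sq_mull.
Qed.

Lemma tor_one_addq i j b b' : i != j -> I b -> I b' ->
  (tor i j 1 (b + b') = tor i j (- b) b' * (tor i j 1 b * tor i j 1 b'))%g.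
Proof.
move=> ij Ib Ib'; have [b0 b0' bb'] := And3 (I_sq Ib Ib) (I_sq Ib' Ib') (I_sq Ib Ib').
rewrite tor_addr // !mul1r tor_addl // !mulgA.
congr (_ * _)%g; apply/commute_sym/K2_central/tor_K2 => //.
by rewrite mulNr bb' oppr0.
Qed.

(* The cocycle tor (ab) (a'b) of the map a |-> tor 1 (ab) is symmetric by
   tor_unit and antisymmetric by tor_swapV. *)
Lemma tor_mod_involutive i j a b : i != j -> I b ->
  exists2 z, involutive_K2 z & tor i j a b = (z * tor i j 1 (a * b))%g.
Proof.
move=> ij Ib; have b0 := I_sq Ib Ib; elim/S_gen: a => [|a u Su [z zK IHa]].
  by exists 1%g; [apply: involutive_K21 | rewrite mul0r tor0l // tor0r mul1g].
have cK : involutive_K2 (tor i j (- (u * b)) (a * b)).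
  by rewrite -mulNr; apply: tor_sq_mul2.
exists (z * tor i j (- (u * b)) (a * b))%g; first exact: involutive_K2M.
rewrite tor_addl // tor_S // IHa mulrDl addrC tor_one_addq //; try exact: IM.
have [zc _] := zK; have [_ c2] := cK.
have zT : commute z (tor i j 1 (u * b)) by apply: K2_central.
by rewrite [LHS]mulgA -zT -[RHS]mulgA (mulgA (tor i j (- _) _)) c2 mul1g mulgA.
Qed.

(** Halving b exhibits the symbol as the square of [tor i j b0 b'], which is involutive since b0 b'
    = 0. *)
Lemma tor_I1 i j b b' : i != j -> I b -> I b' -> tor i j b b' = 1%g.
Proof.
move=> ij Ib Ib'; have [b0 -> b00] := I_half Ib.
rewrite tor_addl //; last exact: I_sq.
have [z [_ z2]] := tor_mod_involutive b0 ij Ib'.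
by rewrite b00 // tor0r mulg1 => ->.
Qed.

Lemma tor_oneD i j b b' : i != j -> I b -> I b' ->
  (tor i j 1 (b + b') = tor i j 1 b * tor i j 1 b')%g.
Proof. by move=> ij Ib Ib'; rewrite tor_one_addq // tor_I1 ?mul1g //; apply: IN. Qed.

Lemma tor_oneE i j a b : i != j -> I b -> tor i j a b = tor i j 1 (a * b).
Proof.
move=> ij Ib; have b0 := I_sq Ib Ib; elim/S_gen: a => [|a u Su IHa].
  by rewrite mul0r tor0l // tor0r.
by rewrite tor_addl // tor_S // IHa mulrDl addrC tor_oneD //; apply: IM.
Qed.

Lemma tor_one_commute i j m b b' g : i != j -> i != m -> j != m -> I b -> I b' ->
  is_diag g (diag2 i m (1 + b) (1 - b)) (diag2 i m (1 - b) (1 + b)) ->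
  commute g (tor i j 1 b').
Proof.
move=> ij im jm Ib Ib' gD; rewrite /commute (is_diag_tor i j 1 b' gD).
rewrite /diag2 eqxx [j == i]eq_sym (negPf ij) (negPf jm) !mulr1 mul1r.
have -> : b' * (1 - b) = b' by rewrite mulrBr mulr1 I_sq ?subr0.
rewrite tor_addl //; last exact: I_sq.
by rewrite tor_I1 // mul1g.
Qed.

Lemma sx_mulV i j a b : i != j -> I b ->
  (sx i j a * sx j i b =
     sx j i b * tor i j 1 (a * b) * sx i j (a * (1 - a * b)))%g.
Proof.
move=> ij Ib; rewrite sx_tor tor_oneE //.
by have b0 := I_sq Ib Ib; congr (sx _ _ _ * _ * _)%g; ring: b0.
Qed.

Lemma is_diag_I_sx k j i b' m b : i != j -> I b -> I b' ->
  commute (tor i j 1 b) (sx k m b').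
Proof.
move=> ij Ib Ib'; rewrite /commute (is_diag_sx k m b' (tor_one_diag ij Ib)).
congr (sx _ _ _ * _)%g; have bb' := I_sq Ib Ib'; have b0 := I_sq Ib Ib.
by rewrite /diag2; do !case: eqP => _; ring: bb' b0.
Qed.

(** Conjugating x_ij(-b) by the Weyl element, once by [weyl_sx] and once letter by letter ([A1] to
    [A3]), gives results that differ by the product of the two opposite torus elements. *)
Lemma tor_one_swap i j b : i != j -> I b -> tor j i 1 b = tor i j 1 (- b).
Proof.
move=> ij Ib; have ji : j != i by rewrite eq_sym.
have INb := IN Ib; have b0 := I_sq Ib Ib.
suff E : (tor j i 1 b * tor i j 1 b = 1)%g.
  by apply: (mulIg (tor i j 1 b)); rewrite E -tor_oneD // addNr tor0r.
have A1 : (sx j i (- 1) * sx i j (- b) =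
    sx i j (- b) * tor j i 1 b * sx j i b * sx j i (- 1))%g.
  rewrite sx_mulV // -(mulgA _ (sx j i b)) -sxD.
  by congr (_ * tor _ _ _ _ * sx _ _ _)%g; ring.
have A2 : (sx i j 1 * tor j i 1 b = tor j i 1 b * sx i j (1 + b + b))%g.
  rewrite (is_diag_sx i j _ (tor_one_diag ji Ib)) /diag2 !eqxx (negPf ij).
  by congr (sx _ _ _ * _)%g; ring: b0.
have A3 : (sx i j (1 + b + b) * sx j i b =
    sx j i b * tor i j 1 b * sx i j b * sx i j 1)%g.
  rewrite sx_mulV // -(mulgA _ (sx i j b)) -sxD.
  by congr (_ * tor _ _ _ _ * sx _ _ _)%g; ring: b0.
have A4 : (sx i j (- b) * sx j i b = sx j i b * sx i j (- b))%g.
  have b0' : - b * b = 0 by ring: b0.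
  by rewrite sx_mulV // b0' tor0r mulg1 subr0 mulr1.
have w1 : (weyl R i j * sx i j (- b) = sx i j (- b) * tor j i 1 b * sx j i b
    * tor i j 1 b * sx i j b * weyl R i j)%g.
  have X1 : commute (sx i j 1) (sx i j (- b)).
    by rewrite /commute -!sxD addrC.
  rewrite weylE -!mulgA X1 !mulgA -(mulgA _ (sx j i (- 1))) A1 !mulgA X1.
  by rewrite -(mulgA _ _ (tor j i 1 b)) A2 !mulgA -(mulgA _ _ (sx j i b)) A3 !mulgA.
have : (sx i j (- b) * tor j i 1 b * sx j i b * tor i j 1 b * sx i j b = sx j i b)%g.
  by apply: (mulIg (weyl R i j)); rewrite -w1 weyl_sx // opprK.
rewrite -(is_diag_I_sx _ _ ji Ib INb) -!mulgA (is_diag_I_sx _ _ ij Ib Ib).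
rewrite (mulgA (sx i j (- b))) A4 -!mulgA (mulgA (sx i j (- b))) -sxD addNr sx0.
rewrite mul1g mulgA (is_diag_I_sx _ _ ji Ib Ib) -mulgA => E.
by apply: (mulgI (sx j i b)); rewrite E mulg1.
Qed.


Lemma IB_unit d d' a : I d -> I d' -> I (a - (1 + d) * a * (1 + d')).
Proof.
move=> Id Id'.
have -> : a - (1 + d) * a * (1 + d') = (- a) * d + (- (a * (1 + d))) * d' by ring.
by apply: ID; apply: IM.
Qed.

Lemma I_sum (J : Type) (r : seq J) (P : pred J) (F : J -> R) :
  (forall l, I (F l)) -> I (\sum_(l <- r | P l) F l).
Proof. by move=> IF; apply: big_ind. Qed.

(* Matrix coordinates on the kernel of St(R) -> St(R/I): the diagonal entry
   (i, i), i > 0, carries diag(1 - b, 1 + b) at positions 0 and i, and (0, 0)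
   is redundant because of the determinant. *)
Definition kgen i j b : St R :=
  if i == j then (if i == 0%N then 1%g else tor 0 i 1 (- b)) else sx i j b.

Lemma kgen0 i j : kgen i j 0 = 1%g.
Proof. by rewrite /kgen oppr0 tor0r sx0; case: ifP => // _; case: ifP. Qed.

Lemma kgenD i j b b' : I b -> I b' ->
  kgen i j (b + b') = (kgen i j b * kgen i j b')%g.
Proof.
move=> Ib Ib'; rewrite /kgen; case: eqP => _; last exact: sxD.
case: (eqVneq i 0%N) => [_|i0]; first by rewrite mulg1.
by rewrite opprD tor_oneD //; [rewrite eq_sym | apply: IN | apply: IN].
Qed.

Lemma sx_commuteI i j k m b b' : I b -> I b' -> commute (sx i j b) (sx k m b').
Proof.
move=> Ib Ib'; have bb' := I_sq Ib Ib'; have b'b := I_sq Ib' Ib.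
have [->|ij] := eqVneq i j; first by rewrite sx_diag; apply/commute_sym/commute1.
have [->|km] := eqVneq k m; first by rewrite sx_diag; apply: commute1.
have [jk|jk] := eqVneq j k; have [im|im] := eqVneq i m.
- rewrite -jk -im /commute sx_mulV //.
  by rewrite mulrBr mulr1 bb' mulr0 subr0 tor0r mulg1.
- by rewrite -jk in km *; rewrite /commute sx_mulC // bb' sx0 mul1g.
- rewrite -im in km *; apply/commute_sym; rewrite eq_sym in jk.
  by rewrite /commute sx_mulC // b'b sx0 mul1g.
- exact: sx_commute.
Qed.

Lemma kgen_commute i j k m b b' : I b -> I b' -> commute (kgen i j b) (kgen k m b').
Proof.
move=> Ib Ib'; have [INb INb'] := conj (IN Ib) (IN Ib'); rewrite /kgen.
case: (eqVneq i j) => [_|ij].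
  case: (eqVneq i 0%N) => [_|i0]; first by apply/commute_sym/commute1.
  have i0' : 0%N != i by rewrite eq_sym.
  case: (eqVneq k m) => [_|km]; last exact: is_diag_I_sx.
  case: (eqVneq k 0%N) => [_|k0]; first exact: commute1.
  have k0' : 0%N != k by rewrite eq_sym.
  have [<-|ik] := eqVneq i k; first by rewrite /commute -!tor_oneD // addrC.
  apply: (tor_one_commute (m := i)) (tor_one_diag i0' INb) => //.
  by rewrite eq_sym.
case: (eqVneq k m) => [_|km]; last exact: sx_commuteI.
case: (eqVneq k 0%N) => [_|k0]; first exact: commute1.
by apply/commute_sym/is_diag_I_sx; rewrite // eq_sym.
Qed.

Definition kprod (L : seq (nat * nat * R)) : St R :=
  (\prod_(l <- L) kgen l.1.1 l.1.2 l.2)%g.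

(** This is the kernel of [St_map f], by [St_map_ker] and [St_map_kpred]. *)
Definition kpred x := exists2 L, {in L, forall l, I l.2} & x = kprod L.

Lemma kpred1 : kpred 1%g.
Proof. by exists [::]; rewrite /kprod ?big_nil. Qed.

Lemma kpredM x y : kpred x -> kpred y -> kpred (x * y)%g.
Proof.
move=> [L LI ->] [L' LI' ->]; exists (L ++ L'); last by rewrite /kprod big_cat.
by move=> l; rewrite mem_cat => /orP[/LI|/LI'].
Qed.

Lemma kpred_gen i j b : I b -> kpred (kgen i j b).
Proof.
move=> Ib; exists [:: (i, j, b)]; last by rewrite /kprod big_seq1.
by move=> l; rewrite inE => /eqP->.
Qed.

Lemma kpred_sx i j b : i != j -> I b -> kpred (sx i j b).
Proof. by move=> /negPf ij Ib; have := @kpred_gen i j b Ib; rewrite /kgen ij. Qed.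

Lemma kpred_tor i b : i != 0%N -> I b -> kpred (tor 0 i 1 b).
Proof.
move=> /negPf i0 Ib; have := @kpred_gen i i (- b) (IN Ib).
by rewrite /kgen eqxx i0 opprK.
Qed.

Lemma kprod_ind (P : St R -> Prop) L : P 1%g ->
  (forall x y, P x -> P y -> P (x * y)%g) ->
  (forall i j b, I b -> P (kgen i j b)) ->
  {in L, forall l, I l.2} -> P (kprod L).
Proof.
move=> P1 PM Pg LI; rewrite /kprod big_seq; apply: big_ind => // l /LI.
exact: Pg.
Qed.

Lemma kpred_ind (P : St R -> Prop) : P 1%g ->
  (forall x y, P x -> P y -> P (x * y)%g) ->
  (forall i j b, I b -> P (kgen i j b)) -> forall x, kpred x -> P x.
Proof. by move=> P1 PM Pg x [L LI ->]; apply: kprod_ind. Qed.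

Lemma kpredV x : kpred x -> kpred x^-1%g.
Proof.
move: x; apply: kpred_ind => [|x y kx ky|i j b Ib].
- by rewrite invg1; apply: kpred1.
- by rewrite invgM; apply: kpredM.
rewrite (_ : _^-1%g = kgen i j (- b)); first exact/kpred_gen/IN.
by apply/mulg1_eq; rewrite -kgenD ?subrr ?kgen0 //; apply: IN.
Qed.

Definition coef L (ij : nat * nat) : R := \sum_(l <- L | l.1 == ij) l.2.

Lemma coefI L ij : {in L, forall l, I l.2} -> I (coef L ij).
Proof. by move=> LI; rewrite /coef big_seq_cond; apply: big_ind => // l /andP[/LI]. Qed.

(** Normal form: the generators commute and are additive in b, so only the total at each position
    matters. *)
Lemma kprod_coef s L : uniq s -> {in L, forall l, I l.2} ->
  {in L, forall l, l.1 \in s} ->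
  kprod L = (\prod_(ij <- s) kgen ij.1 ij.2 (coef L ij))%g.
Proof.
move=> us; elim: L => [|l L IHL] LI Ls.
  by rewrite /kprod big_nil big1 // => ij _; rewrite /coef big_nil kgen0.
have LI' : {in L, forall l, I l.2} by move=> l' l'L; apply: LI; rewrite inE l'L orbT.
have Il : I l.2 by apply: LI; rewrite inE eqxx.
rewrite /kprod big_cons -/(kprod L) IHL //; last first.
  by move=> l' l'L; apply: Ls; rewrite inE l'L orbT.
pose f (ij : nat * nat) : R := if l.1 == ij then l.2 else 0.
have fI ij : I (f ij) by rewrite /f; case: ifP.
have -> : (kgen l.1.1 l.1.2 l.2 = \prod_(ij <- s) kgen ij.1 ij.2 (f ij))%g.
  rewrite (prodg_only (z := l.1)) //.
  - by rewrite /f eqxx.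
  - by apply: Ls; rewrite inE eqxx.
  - by move=> k kl; rewrite /f eq_sym (negPf kl) kgen0.
rewrite -prodgM_commute => [|ij ij' _ _]; last first.
  by apply: kgen_commute => //; apply: coefI.
apply: eq_bigr => ij _; rewrite -kgenD //; last exact: coefI.
by rewrite /f {2}/coef big_cons; case: ifP; rewrite ?add0r.
Qed.

(** The matrix of the generator minus the identity; a diagonal generator at i > 0 also puts -b at
    (0, 0). *)
Definition kact (l : nat * nat * R) (v : nat -> R) : nat -> R := fun k =>
  if l.1 == (0%N, 0%N) then 0 else
  (if k == l.1.1 then l.2 * v l.1.2 else 0)
  - (if (l.1.1 == l.1.2) && (k == 0%N) then l.2 * v 0%N else 0).

Lemma act_kgen i j b v k : I b ->
  St_act (kgen i j b) v k = v k + kact (i, j, b) v k.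
Proof.
move=> Ib; rewrite /kgen /kact /= xpair_eqE.
case: (eqVneq i j) => [<-|ij].
  case: (eqVneq i 0%N) => [_|i0] /=; first by rewrite St_act1 addr0.
  have i0' : 0%N != i by rewrite eq_sym.
  have [-> _] := tor_one_diag i0' (IN Ib); rewrite /diag2.
  case: (eqVneq k 0%N) => [->|_]; first by rewrite (negPf i0'); ring.
  by case: (eqVneq k i) => [->|_]; ring.
rewrite St_act_sx // /elem_act /= subr0.
have -> : (i == 0%N) && (j == 0%N) = false.
  by apply: contraNF ij => /andP[/eqP-> /eqP->].
by case: ifP => _; rewrite ?addr0.
Qed.

(** Cross terms lie in I^2 = 0, so the deviations from the identity add up. *)
Lemma act_kprod L v k : {in L, forall l, I l.2} ->
  St_act (kprod L) v k = v k + \sum_(l <- L) kact l v k.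
Proof.
move=> LI; elim: L LI k => [|[[i j] b] L IHL] LI k.
  by rewrite /kprod !big_nil addr0 St_act1.
have LI' : {in L, forall l, I l.2} by move=> l' l'L; apply: LI; rewrite inE l'L orbT.
have Ib : I b by apply: (LI (i, j, b)); rewrite inE eqxx.
rewrite /kprod !big_cons -/(kprod L) St_actM /= act_kgen // IHL //.
rewrite -addrA; congr (_ + _); rewrite addrC; congr (_ + _).
have kI l v' k' : l \in L -> I (kact l v' k').
  move=> /LI' Il; rewrite /kact; case: ifP => // _; apply: ID; last apply: IN.
    by case: ifP => // _; rewrite mulrC; apply: IM.
  by case: ifP => // _; rewrite mulrC; apply: IM.
have bE m : b * St_act (kprod L) v m = b * v m.
  have cI : I (\sum_(l <- L) kact l v m).
    by rewrite big_seq; apply: big_ind => // l lL; apply: kI.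
  by rewrite IHL // mulrDr (I_sq Ib cI) addr0.
by rewrite /kact /= !bE.
Qed.

Lemma kact_basis l j k : (k, j) != (0%N, 0%N) ->
  kact l (basis_vec R j) k = if l.1 == (k, j) then l.2 else 0.
Proof.
move=> kj; rewrite /kact /basis_vec; case: eqP => [->|_].
  by rewrite eq_sym (negPf kj).
rewrite (surjective_pairing l.1) xpair_eqE /=.
have -> : (if (l.1.1 == l.1.2) && (k == 0%N) then l.2 * (0%N == j)%:R else 0) = 0 :> R.
  case: ifP => // /andP[_ /eqP k0]; rewrite k0 xpair_eqE eqxx /= in kj.
  by rewrite eq_sym (negPf kj) mulr0.
rewrite subr0 [k == _]eq_sym; case: eqP => //= _.
by case: eqP => _; rewrite ?mulr1 ?mulr0.
Qed.

(** Away from (0, 0) each total coefficient is an entry of the matrix of x minus 1, hence 0; at (0,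
    0) the generator is trivial. *)
Lemma kpred_inj x : kpred x -> St_act x = id -> x = 1%g.
Proof.
move=> [L LI ->] L1; rewrite (kprod_coef (undup_uniq [seq l.1 | l <- L]) LI).
  rewrite big1 // => -[k j] _ /=; have [[-> ->]|kj] := eqVneq (k, j) (0%N, 0%N).
    by rewrite /kgen.
  suff -> : coef L (k, j) = 0 by rewrite kgen0.
  have := act_kprod (basis_vec R j) k LI; rewrite L1 /= => /esym/(canRL (addKr _)).
  rewrite addNr => E; rewrite /coef big_mkcond /= -[RHS]E.
  by apply: eq_bigr => l _; rewrite kact_basis.
by move=> l lL; rewrite mem_undup; apply: map_f.
Qed.

(** * Normality of the subgroup [kpred] *)

Definition knorm g := forall x, kpred x -> kpred (x ^ g^-1)%g.

Lemma knormM g h : knorm g -> knorm h -> knorm (g * h)%g.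
Proof. by move=> ng nh x kx; rewrite invgM conjgM; apply/ng/nh. Qed.

(** Only conjugating the opposite root element x_ji(b) creates a new torus element,
    [tor i j 1 (a * b)]; the second hypothesis takes care of it. *)
Lemma knorm_sx i j a : i != j -> (forall b, I b -> kpred (tor i j 1 b)) ->
  knorm (sx i j a).
Proof.
move=> ij ktor; apply: kpred_ind => [|x y|k m b Ib].
- by rewrite conj1g; apply: kpred1.
- by rewrite conjMg; apply: kpredM.
have kb := kpred_gen k m Ib; rewrite /kgen in kb *; case: (eqVneq k m) kb => [_|km] kb.
  case: (eqVneq k 0%N) kb => [_|k0] kb; first by rewrite conj1g; apply: kpred1.
  rewrite eq_sym in k0; have tD := tor_one_diag k0 (IN Ib).
  rewrite conjgE invgK -sxN (is_diag_sx i j (- a) tD) mulgA -sxD.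
  apply: kpredM => //; apply: kpred_sx => //.
  have dI n : exists2 c, I c & diag2 0 k (1 + - b) (1 - - b) n = 1 + c.
    rewrite /diag2; case: eqP => _; first by exists (- b); [apply: IN|].
    case: eqP => _; first by exists b; rewrite ?opprK.
    by exists 0; rewrite ?addr0.
  have dI' n : exists2 c, I c & diag2 0 k (1 - - b) (1 + - b) n = 1 + c.
    rewrite /diag2; case: eqP => _; first by exists b; rewrite ?opprK.
    case: eqP => _; first by exists (- b); [apply: IN|].
    by exists 0; rewrite ?addr0.
  have [[c Ic ->] [c' Ic' ->]] := (dI i, dI' j).
  by rewrite mulrN mulNr; apply: IB_unit.
have [jk|jk] := eqVneq j k; have [im|im] := eqVneq i m.
- rewrite -jk -im in km *; rewrite conjgE invgK mulgA sx_mulV // -sxN -mulgA -sxD.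
  apply: kpredM; first by apply: kpredM; [apply: kpred_sx | apply/ktor/IM].
  apply: kpred_sx => //; have -> : a * (1 - a * b) - a = - (a * a) * b by ring.
  exact: IM.
- rewrite -jk in km *; rewrite sx_conj_l //.
  by apply: kpredM; apply: kpred_sx => //; apply: IM.
- rewrite -im in km *; rewrite eq_sym in jk; rewrite sx_conj_r //.
  apply: kpredM; apply: kpred_sx => //.
  by rewrite -mulNr mulrC; apply/IM/IN.
- by rewrite sx_conj_id //; apply: kpred_sx.
Qed.

(** Torus elements are available as generators only for pairs (0, i), and for (i, 0) through
    [tor_one_swap]. The other x_ij are commutators of x_i0 and x_0j. *)
Lemma knorm_all g : knorm g.
Proof.
have n0 k a : k != 0%N -> knorm (sx 0 k a) /\ knorm (sx k 0 a).
  move=> k0; have k0' : 0%N != k by rewrite eq_sym.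
  split; apply: knorm_sx => // b Ib; first exact: kpred_tor.
  by rewrite tor_one_swap //; apply/kpred_tor/IN.
elim/St_ind: g => [|i j a x ij nx]; first by move=> x; rewrite invg1 conjg1.
apply: knormM nx; have [i0|i0] := eqVneq i 0%N.
  by rewrite i0 in ij *; apply: (n0 _ _ _).1; rewrite eq_sym.
have [j0|j0] := eqVneq j 0%N; first by rewrite j0 in ij *; apply: (n0 _ _ _).2.
have j0' : 0%N != j by rewrite eq_sym.
rewrite -[a]mulr1 -(sx_comm _ _ i0 j0' ij) commgEl conjgE -!sxN.
apply: knormM; first exact: (n0 _ _ _).2.
apply: knormM; first exact: (n0 _ _ _).1.
by apply: knormM; [exact: (n0 _ _ _).2 | exact: (n0 _ _ _).1].
Qed.


Definition kcong x y := kpred (x * y^-1)%g.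

Lemma kcong_refl x : kcong x x.
Proof. by rewrite /kcong mulgV; apply: kpred1. Qed.

Lemma kcong_sym x y : kcong x y -> kcong y x.
Proof. by move/kpredV; rewrite invgM invgK. Qed.

Lemma kcong_trans y x z : kcong x y -> kcong y z -> kcong x z.
Proof. by move=> xy /(kpredM xy); rewrite mulgA mulgVK. Qed.

Lemma kcongM x x' y y' : kcong x x' -> kcong y y' -> kcong (x * y)%g (x' * y')%g.
Proof.
move=> xx' yy'; rewrite /kcong invgM mulgA -(mulgA x).
have -> : (x * (y * y'^-1) * x'^-1 = (y * y'^-1) ^ x^-1 * (x * x'^-1))%g.
  by rewrite conjgE invgK !mulgA mulgVK.
by apply: kpredM; first apply: knorm_all.
Qed.

Lemma kcong_sx i j a a' : i != j -> I (a - a') -> kcong (sx i j a) (sx i j a').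
Proof. by move=> ij aa'; rewrite /kcong -sxN -sxD; apply: kpred_sx. Qed.

(** * The kernel of St(R) -> St(R/I) and the map on K_2 *)

Section Quotient.
Variables (B : comPzRingType) (f : {rmorphism R -> B}).
Hypothesis f_surj : forall b : B, exists a, f a = b.
Hypothesis f_ker : forall a, f a = 0 <-> I a.

Lemma f_eqI a a' : f a = f a' <-> I (a - a').
Proof.
by rewrite -f_ker rmorphB; split=> [->|/eqP]; rewrite ?subrr // subr_eq0 => /eqP.
Qed.

Definition f_lift (b : B) : R := projT1 (cid (f_surj b)).

Lemma f_liftK (b : B) : f (f_lift b) = b.
Proof. exact: projT2 (cid (f_surj b)). Qed.

(** As [f_lift] is merely a set-theoretic section, the Steinberg relations lift only modulo
    [kpred]. *)
Definition letter_lift (l : stgen B * bool) : St R :=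
  let: (i, j, b) := val l.1 in sx i j ((-1) ^+ l.2 * f_lift b).

Definition word_lift (w : gword (stgen B)) : St R := (\prod_(l <- w) letter_lift l)%g.

Lemma word_lift_cat (u w : gword (stgen B)) :
  word_lift (u ++ w) = (word_lift u * word_lift w)%g.
Proof. exact: big_cat. Qed.

Lemma word_lift_stx i j (ij : i != j) (b : B) :
  word_lift (stx ij b) = sx i j (f_lift b).
Proof. by rewrite /word_lift big_seq1 /letter_lift /= mul1r. Qed.

Lemma word_lift_comm i j k m (ij : i != j) (km : k != m) (b b' : B) :
  word_lift (wcomm (stx ij b) (stx km b')) =
    [~ sx i j (- f_lift b), sx k m (- f_lift b')]%g.
Proof.
rewrite /wcomm !word_lift_cat !word_lift_stx /word_lift !big_seq1 /letter_lift /=.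
by rewrite !mulN1r commgEl conjgE !sxN !invgK !mulgA.
Qed.

Lemma word_lift_eq (u w : gword (stgen B)) : pres_eq (@steinberg_rel B) u w ->
  kcong (word_lift u) (word_lift w).
Proof.
elim=> {u w} [u|u w _ /kcong_sym //|u w z _ + _|u u' w w' _ + _|[[[i j] b] ij] e|u w].
- exact: kcong_refl.
- exact: kcong_trans.
- by rewrite !word_lift_cat; apply: kcongM.
- rewrite /word_lift !big_cons big_nil mulg1 /letter_lift /= -sxD -mulrDl.
  have -> : (-1) ^+ e + (-1) ^+ (~~ e) = 0 :> R.
    by case: e; rewrite expr0 expr1 ?addNr ?subrr.
  by rewrite mul0r sx0; apply: kcong_refl.
case=> {u w} [i j ij a b|i j k ij jk ik a b|i j k m ij km a b jk im].
- rewrite word_lift_cat !word_lift_stx -sxD; apply: kcong_sx => //.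
  by apply/f_eqI; rewrite rmorphD /= !f_liftK.
- rewrite word_lift_comm sx_comm // word_lift_stx; apply: kcong_sx => //.
  by apply/f_eqI; rewrite rmorphM /= !f_liftK.
- rewrite word_lift_comm /word_lift big_nil.
  have /commgP/eqP-> := @sx_commute _ i j k m (- f_lift a) (- f_lift b) jk im.
  exact: kcong_refl.
Qed.

Lemma word_lift_map (w : gword (stgen R)) :
  kcong (word_lift (word_map f w)) (presclass (@steinberg_rel R) w).
Proof.
elim: w => [|[[[[i j] a] ij] e] w IHw].
  by rewrite /word_lift big_nil; apply: kcong_refl.
rewrite -cat1s St_classM /word_map map_cat -/(word_map f w) word_lift_cat.
apply: kcongM => //; rewrite St_class_letter /word_lift big_seq1 /letter_lift /=.
by apply: kcong_sx => //; apply/f_eqI; rewrite !rmorphM /= f_liftK.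
Qed.

(** Lifting words inverts [St_map f] modulo [kpred]; normality of [kpred] makes this well defined
    ([word_lift_eq]). *)
Lemma St_map_ker x : St_map f x = 1%g -> kpred x.
Proof.
move=> /presclassP/word_lift_eq; rewrite [word_lift [::]]big_nil.
move=> /(kcong_trans (kcong_sym (word_lift_map _))); rewrite presclass_repr.
by rewrite /kcong invg1 mulg1.
Qed.

Lemma St_map_kpred x : kpred x -> St_map f x = 1%g.
Proof.
have f0 b : I b -> f b = 0 by move/f_ker.
move: x; apply: kpred_ind => [|x y|i j b Ib]; first exact: St_map1.
  by rewrite St_mapM => -> ->; rewrite mulg1.
rewrite /kgen; case: ifP => _; last by rewrite St_map_sx f0 // sx0.
case: ifP => _; first exact: St_map1.
rewrite torE !St_mapM !St_map_sx !(rmorphN, rmorphM, rmorphB, rmorph1) /= (f0 _ Ib).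
by rewrite !(oppr0, mulr0, subr0, mulr1, sx0, mulg1, mul1g) -sxD subrr sx0.
Qed.

Lemma act_kpred x v k : kpred x -> I (St_act x v k - v k).
Proof.
move=> [L LI ->]; rewrite act_kprod // addrC addKr big_seq.
apply: big_ind => // l /LI Il; rewrite /kact; case: ifP => // _.
by apply: ID; [|apply: IN]; case: ifP => // _; rewrite mulrC; apply: IM.
Qed.

(* Up to the entry (0, 0) a matrix congruent to 1 mod I is the image of a kprod,
   and the determinant settles the remaining entry. *)
Lemma congruence_lift x : (forall v k, I (St_act x v k - v k)) ->
  exists2 y, kpred y & St_act y = St_act x.
Proof.
move=> xI; have [M M0 [xout xin]] := St_act_bound x.
pose c k j := St_act x (basis_vec R j) k - basis_vec R j k.
have cI k j : I (c k j) by apply: xI.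
pose L := [seq (k, j, c k j) | k <- iota 0 M, j <- iota 0 M].
have LI : {in L, forall l, I l.2} by move=> l /allpairsP[[k j] [_ _ ->]]; apply: cI.
have kL : kpred (kprod L) by exists L.
have LE v k : \sum_(l <- L) kact l v k =
    \sum_(i <- iota 0 M) \sum_(j <- iota 0 M) kact (i, j, c i j) v k.
  by rewrite big_allpairs_dep.
(* At (0, 0), x has 1 + c 0 0 while [kprod L] has 1 minus the sum of the c i i over i > 0; the trace
   t is the discrepancy. *)
pose t := \sum_(i <- iota 0 M) c i i.
have only (F : nat -> R) k : (forall i, i != k -> F i = 0) ->
    \sum_(i <- iota 0 M) F i = if (k < M)%N then F k else 0.
  move=> Fk; case: ltnP => kM.
    by rewrite (bigD1_seq k) ?mem_iota ?iota_uniq //= big1 ?addr0.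
  rewrite big_seq big1 // => i; rewrite mem_iota => /andP[_ iM]; apply: Fk.
  by rewrite ltn_eqF // (leq_trans iM).
have xc v k : St_act x v k = v k + if (k < M)%N then \sum_(j <- iota 0 M) c k j * v j else 0.
  case: ltnP => kM; last by rewrite xout // addr0.
  under eq_bigr => j _ do rewrite mulrBl.
  rewrite sumrB -xin // (only (fun j => basis_vec R j k * v j) k).
    by rewrite kM /basis_vec eqxx mul1r addrC subrK.
  by move=> j /negPf jk; rewrite /basis_vec eq_sym jk mul0r.
have kactE v k i j : kact (i, j, c i j) v k =
    (if k == i then c i j * v j else 0) -
    (if (i == j) && (k == 0%N) then c i j * v 0%N else 0).
  rewrite /kact /=; case: eqP => // -[-> ->]; rewrite eqxx /=.
  by case: eqP => _; rewrite ?subrr ?subr0.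
have Lc v k : St_act (kprod L) v k + (if k == 0%N then t * v 0%N else 0) = St_act x v k.
  rewrite act_kprod // LE xc -addrA; congr (_ + _).
  under eq_bigr => i _ do under eq_bigr => j _ do rewrite kactE.
  under eq_bigr => i _ do rewrite sumrB.
  rewrite sumrB (only (fun i => \sum_(j <- iota 0 M) (if k == i then _ else 0)) k).
    rewrite eqxx; case: (eqVneq k 0%N) => [k0|_]; last first.
      rewrite [X in _ - X]big1 ?subr0 ?addr0 // => i _.
      by rewrite big1 // => j _; rewrite andbF.
    rewrite k0 M0 -addrA -[RHS]addr0; congr (_ + _); apply/eqP.
    rewrite addrC subr_eq0 /t mulr_suml big_seq [eqbRHS]big_seq; apply/eqP.
    apply: eq_bigr => i; rewrite mem_iota => /andP[_ iM].
    rewrite (only _ i) => [|j /negPf ji]; first by rewrite iM eqxx.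
    by rewrite eq_sym ji.
  by move=> i /negPf ik; rewrite eq_sym ik big1.
exists (kprod L) => //; suff t0 : t = 0.
  by apply/funext => v; apply/funext => k; rewrite -Lc t0 mul0r; case: ifP; rewrite addr0.
(* This quotient acts as diag(1 + t, 1, ..., 1), since t in I kills the deviation of [kprod L] from
   the identity. *)
apply: (@St_act_det _ (x * (kprod L)^-1)%g) => v k.
rewrite St_actM /= -Lc -[St_act _ (St_act _ v)]/((St_act _ \o St_act _) v) St_actKV.
congr (_ + _); case: ifP => // _; have tI : I t by apply: I_sum.
rewrite -[RHS]addr0 -(I_sq tI (act_kpred v 0 (kpredV kL))).
by rewrite mulrBr addrC subrK.
Qed.

Lemma K2_map_inj x : x \in @K2_pred R -> St_map f x = 1%g -> x = 1%g.
Proof. by move=> /K2P x1 /St_map_ker/kpred_inj; apply. Qed.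

(** A lift of y acts as the identity modulo I, hence like some z in the kernel; dividing by z puts
    it in K_2 without changing its image. *)
Lemma K2_map_surj (y : St B) : y \in @K2_pred B ->
  exists2 x, x \in @K2_pred R & St_map f x = y.
Proof.
move=> /K2P y1; have [x xy] := St_map_surj f_surj y.
have [z kz zx] : exists2 z, kpred z & St_act z = St_act x.
  apply: congruence_lift => v k; apply/f_eqI.
  by have := congr1 (@^~ k) (act_St_map f x v); rewrite xy y1.
exists (z^-1 * x)%g; last by rewrite St_mapM St_mapV (St_map_kpred kz) invg1 mul1g.
by apply/K2P; rewrite St_actM -zx -St_actM mulVg St_act1.
Qed.

Theorem K2_square_zero_iso : group_iso (K2 R) (K2 B).
Proof.
have mapK (x : K2 R) : St_map f (val x) \in @K2_pred B.
  apply/K2P/funext => v; have /K2P x1 := valP x.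
  pose v' k := f_lift (v k).
  have -> : v = f \o v' by apply/funext => k; rewrite /v' /= f_liftK.
  by rewrite act_St_map x1.
pose g (x : K2 R) : K2 B := exist _ (St_map f (val x)) (mapK x).
have gM : {morph g : x y / (x * y)%g} by move=> x y; apply: val_inj; apply: St_mapM.
pose gMul := isMultiplicative.Build (K2 R) (K2 B) g gM.
pose gm : {multiplicative K2 R -> K2 B} := HB.pack g gMul.
have g_inj : injective g.
  move=> x y /(congr1 val) /= xy; apply: val_inj; apply: divg1_eq.
  apply: K2_map_inj; last by rewrite St_mapM St_mapV xy mulgV.
  exact: valP (x * y^-1)%g.
have g_surj (y : K2 B) : exists x : K2 R, g x = y.
  have [x xK xy] := K2_map_surj (valP y).
  by exists (exist _ x xK); apply: val_inj.
exists gm; exists (fun y : K2 B => projT1 (cid (g_surj y))) => [x|y] /=.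
  by apply: g_inj; apply: projT2 (cid (g_surj _)).
exact: projT2 (cid (g_surj y)).
Qed.

End Quotient.
End SquareZero.

(** * Integrality in orders of Q[G] *)

Section Integrality.
Variable G : finGroupType.
Hypothesis cG : abelian [set: G].

Definition chi_lin (i : Iirr [set: G]) (y : grpring rat G) : algC :=
  \sum_g ratr (y g : rat) * 'chi_i g.

Lemma chi_linD i : {morph chi_lin i : y z / y + z}.
Proof.
move=> y z; rewrite /chi_lin -big_split /=; apply: eq_bigr => g _.
by rewrite ffunE rmorphD mulrDl.
Qed.

Lemma chi_linMz i y (m : int) : chi_lin i (y *~ m) = chi_lin i y *~ m.
Proof.
have c0 : chi_lin i 0 = 0 by apply: (addrI (chi_lin i 0)); rewrite -chi_linD !addr0.
have cN z : chi_lin i (- z) = - chi_lin i z.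
  by apply/eqP; rewrite -addr_eq0 -chi_linD addNr c0.
have cX z n : chi_lin i (z *+ n) = chi_lin i z *+ n.
  by elim: n => [|n IHn]; rewrite ?mulr0n // !mulrS chi_linD IHn.
by case: m => n; rewrite ?NegzE ?mulrNz ?cN -!pmulrn cX.
Qed.

Lemma chi_lin1 i : chi_lin i 1 = 1.
Proof.
have lin := (char_abelianP _ cG) i.
rewrite /chi_lin (bigD1 1%g) //= ffunE eqxx rmorph1 mul1r (lin_char1 lin).
by rewrite big1 ?addr0 // => g /negPf g1; rewrite ffunE g1 rmorph0 mul0r.
Qed.

Lemma chi_linM i : {morph chi_lin i : y z / y * z}.
Proof.
have lin := (char_abelianP _ cG) i; move=> y z; rewrite /chi_lin.
transitivity (\sum_g \sum_h
    ratr (y h : rat) * 'chi_i h * (ratr (z (h^-1 * g)%g : rat) * 'chi_i (h^-1 * g)%g)).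
  apply: eq_bigr => g _; rewrite ffunE rmorph_sum mulr_suml.
  apply: eq_bigr => h _; have E := lin_charM lin (in_setT h) (in_setT (h^-1 * g)%g).
  by rewrite mulKVg in E; rewrite rmorphM /= [RHS]mulrACA -E.
rewrite exchange_big mulr_suml; apply: eq_bigr => h _; rewrite -mulr_sumr.
by congr (_ * _); rewrite [RHS](reindex_inj (mulgI h^-1%g)).
Qed.

(** For abelian G the irreducible characters add up to the regular character, which is |G| at 1 and
    0 elsewhere. *)
Lemma sum_chi_lin y : \sum_i chi_lin i y = ratr (y 1%g : rat) *+ #|G|.
Proof.
rewrite /chi_lin exchange_big /=.
have E g : \sum_(i : Iirr [set: G]) 'chi_i g = #|G|%:R *+ (g == 1%g).
  have := congr1 (fun phi : 'CF([set: G]) => phi g) (cfReg_sum [set: G]).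
  rewrite cfRegE cardsT sum_cfunE => ->; apply: eq_bigr => i _.
  by rewrite cfunE (lin_char1 ((char_abelianP _ cG) i)) mul1r.
rewrite (bigD1 1%g) //= -mulr_sumr E eqxx mulr1n mulr_natr big1 ?addr0 // => g /negPf g1.
by rewrite -mulr_sumr E g1 mulr0n mulr0.
Qed.

Lemma Zorder_integral (L : {pred grpring rat G}) y : Zorder L -> contains_ZG L ->
  y \in L -> forall g, exists c : int, (y g : rat) *+ #|G| = c%:~R.
Proof.
move=> [[L1 LB LM] [m [s sP]] _] ZL.
(* Multiplication by g^-1, an element of L, moves the coefficient at g to 1. *)
suff at1 z : z \in L -> exists c : int, (z 1%g : rat) *+ #|G| = c%:~R.
  move=> yL g; pose d : grpring int G := [ffun h => (h == g^-1%g)%:R].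
  have [c] := at1 _ (LM _ _ yL (ZL d)); rewrite ffunE => E; exists c; rewrite -E.
  congr (_ *+ _); rewrite (bigD1 g) //= !ffunE mulg1 eqxx mulr1 big1 ?addr0 // => h hg.
  by rewrite !ffunE mulg1 (inj_eq invg_inj) (negPf hg) mulr0.
(* The image of L under a character is a ring that is finitely generated over Z, so it consists of
   algebraic integers. *)
move=> zL; pose S i : {pred algC} := fun c => `[< exists2 x, x \in L & c = chi_lin i x >].
have SP i c : reflect (inIntSpan [tuple chi_lin i s`_j | j < m] c) (c \in S i).
  apply: (iffP (asboolP _)) => [[x /sP[a ->] ->]|[a ->]].
    exists a; rewrite (big_morph (chi_lin i) (chi_linD i) (id1 := 0)); last first.
      by apply: (addrI (chi_lin i 0)); rewrite -chi_linD !addr0.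
    by apply: eq_bigr => j _; rewrite chi_linMz nth_mktuple.
  exists (\sum_(j < m) s`_j *~ a j); first by apply/sP; exists a.
  rewrite (big_morph (chi_lin i) (chi_linD i) (id1 := 0)); last first.
    by apply: (addrI (chi_lin i 0)); rewrite -chi_linD !addr0.
  by apply: eq_bigr => j _; rewrite chi_linMz nth_mktuple.
have SM i : mulr_closed (S i).
  split; first by apply/asboolP; exists 1; rewrite ?chi_lin1.
  move=> b c /asboolP[x xL ->] /asboolP[x' x'L ->]; apply/asboolP.
  by exists (x * x'); rewrite ?chi_linM //; apply: LM.
have zA i : chi_lin i z \in Aint.
  by apply: (fin_Csubring_Aint (SM i) (SP i)); apply/asboolP; exists z.
have zI : ratr ((z 1%g : rat) *+ #|G|) \in Aint.
  by rewrite rmorphMn /= -sum_chi_lin rpred_sum.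
have /Num.Theory.intrP[c cE] := Cint_rat_Aint (Crat_rat _) zI; exists c.
apply: (fmorph_inj (@ratr algC)); apply: etrans cE _.
exact/esym/ratr_int.
Qed.

End Integrality.

(** * Quotient rings and the maps between them *)

Section Quotients.
Variable R : pzRingType.

Lemma ring_quot_pi0 (T : R -> Prop) : ring_quot_pi T 0 = 0.
Proof. by apply: (addrI (ring_quot_pi T 0)); rewrite -ring_quot_piD !addr0. Qed.

Lemma ring_quot_pi_eq0 (T : R -> Prop) x : ring_quot_pi T x = 0 <-> x \in ideal_gen T.
Proof. by rewrite -(ring_quot_pi0 T) ring_quot_eqP subr0. Qed.

Lemma ring_quot_piMn (T : R -> Prop) x m :
  ring_quot_pi T (x *+ m) = ring_quot_pi T x *+ m.
Proof. by elim: m => [|m IHm]; rewrite ?ring_quot_pi0 // !mulrS ring_quot_piD IHm. Qed.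

Lemma ring_quot_piN (T : R -> Prop) x : ring_quot_pi T (- x) = - ring_quot_pi T x.
Proof. by apply/eqP; rewrite -addr_eq0 -ring_quot_piD addNr ring_quot_pi0. Qed.

Lemma ring_quot_piMz (T : R -> Prop) x (c : int) :
  ring_quot_pi T (x *~ c) = ring_quot_pi T x *~ c.
Proof.
case: c => m; first by rewrite -!pmulrn ring_quot_piMn.
by rewrite NegzE !mulrNz -!pmulrn -ring_quot_piMn ring_quot_piN.
Qed.

Lemma ideal_gen_natr c (z : R) :
  z \in ideal_gen (fun x : R => x = c%:R) <-> exists y, z = y *+ c.
Proof.
split=> [/asboolP[t [tc ->]]|[y ->]].
  exists (\sum_(u <- t) u.1.1 * u.2); rewrite -sumrMnl.
  rewrite big_seq [RHS]big_seq; apply: eq_bigr => u /tc->.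
  by rewrite mulr_natr mulrnAl.
apply/asboolP; exists [:: (y, c%:R, 1)]; split; last by rewrite big_seq1 mulr_natr mulr1.
by move=> u; rewrite inE => /eqP->.
Qed.

Variables T1 T2 : R -> Prop.
Hypothesis T12 : forall x, x \in ideal_gen T1 -> x \in ideal_gen T2.

Definition quot_map (x : ring_quot T1) : ring_quot T2 := ring_quot_pi T2 (repr x).

Lemma quot_map_pi x : quot_map (ring_quot_pi T1 x) = ring_quot_pi T2 x.
Proof.
by apply/ring_quot_eqP/T12/ring_quot_eqP; rewrite /ring_quot_pi reprK.
Qed.

Lemma quot_map_zmod : zmod_morphism quot_map.
Proof.
move=> x y; have [[a ->] [b ->]] := conj (ring_quot_piP x) (ring_quot_piP y).
by rewrite -ring_quot_piN -ring_quot_piD !quot_map_pi ring_quot_piD ring_quot_piN.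
Qed.

Lemma quot_map_monoid : monoid_morphism quot_map.
Proof.
split=> [|x y]; first exact: quot_map_pi.
have [[a ->] [b ->]] := conj (ring_quot_piP x) (ring_quot_piP y).
rewrite -[ring_quot_pi T1 a * _]/(ring_quot_mul _ _) -ring_quot_piM !quot_map_pi.
exact: ring_quot_piM.
Qed.

Lemma ring_quot_mulC (T : R -> Prop) : commutative (@GRing.mul R) ->
  commutative (@GRing.mul (ring_quot T)).
Proof.
move=> RC x y; have [[a ->] [b ->]] := conj (ring_quot_piP x) (ring_quot_piP y).
by rewrite -[LHS]ring_quot_piM -[RHS]ring_quot_piM RC.
Qed.

End Quotients.

(** * Z[G] inside Q[G] *)

Section GroupRing.
Variable G : finGroupType.
Implicit Types (x y : grpring int G).

Lemma grpring_mulC (R : comPzRingType) : abelian [set: G] ->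
  commutative (@GRing.mul (grpring R G)).
Proof.
move=> cG x y; apply/ffunP => g; rewrite !ffunE.
have gC a b : (a * b = b * a :> G)%g by apply: (centsP cG); rewrite inE.
rewrite (reindex_inj invg_inj) (reindex_inj (mulIg g^-1%g)) /=.
by apply: eq_bigr => h _; rewrite invgK mulgVK invMg invgK (gC g) mulrC.
Qed.

Lemma grpring_ZtoQ_inj : injective (@grpring_ZtoQ G).
Proof.
by move=> x y /ffunP xy; apply/ffunP => g; have := xy g; rewrite !ffunE => /intr_inj.
Qed.

Lemma grpring_ZtoQD : {morph @grpring_ZtoQ G : x y / x + y}.
Proof. by move=> x y; apply/ffunP => g; rewrite !ffunE rmorphD. Qed.

Lemma grpring_ZtoQ0 : grpring_ZtoQ (0 : grpring int G) = 0.
Proof. by apply/ffunP => g; rewrite !ffunE. Qed.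

Lemma grpring_ZtoQMn x m : grpring_ZtoQ (x *+ m) = grpring_ZtoQ x *+ m.
Proof.
by elim: m => [|m IHm]; rewrite ?grpring_ZtoQ0 // !mulrS grpring_ZtoQD IHm.
Qed.

Lemma grpring_ZtoQM : {morph @grpring_ZtoQ G : x y / x * y}.
Proof.
move=> x y; apply/ffunP => g; rewrite !ffunE rmorph_sum.
by apply: eq_bigr => h _; rewrite rmorphM !ffunE.
Qed.

Definition grpring_basis (g : G) : grpring int G := [ffun h => (h == g)%:R].

Lemma grpring_basisM g h :
  grpring_basis g * grpring_basis h = grpring_basis (g * h)%g.
Proof.
apply/ffunP => t; rewrite !ffunE (bigD1 g) //= !ffunE eqxx mul1r.
rewrite big1 ?addr0 => [|s /negPf sg]; last by rewrite !ffunE sg mul0r.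
by rewrite -(inj_eq (mulgI g)) mulKVg.
Qed.

Lemma grpring_basis1 : grpring_basis 1%g = 1.
Proof. by apply/ffunP => t; rewrite !ffunE. Qed.

Lemma grpring_basisX g m : grpring_basis (g ^+ m)%g = grpring_basis g ^+ m.
Proof.
by elim: m => [|m IHm]; rewrite ?grpring_basis1 // expgS exprS -grpring_basisM IHm.
Qed.

Lemma grpring_sum_basis x : x = \sum_g grpring_basis g *~ (x g : int).
Proof.
apply/ffunP => h; rewrite sum_ffunE (bigD1 h) //= big1 => [|g /negPf gh].
  by rewrite addr0 ffunMzE ffunE eqxx intz.
by rewrite ffunMzE ffunE eq_sym gh mul0rz.
Qed.

End GroupRing.

Lemma expr1D_cube (R : comPzRingType) (z : R) m : z * z * z = 0 ->
  (1 + z) ^+ m = 1 + z *+ m + z * z *+ 'C(m, 2).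
Proof.
move=> z3; elim: m => [|m IHm]; first by rewrite expr0 !mulr0n !addr0.
rewrite exprS IHm binS bin1 !mulrSr mulrnDr mulrDl mul1r.
rewrite !mulrDr mulr1 !mulrnAr mulrA z3 mul0rn addr0.
by rewrite -!addrA; congr (_ + (_ + _)); rewrite [RHS]addrCA; congr (_ + _); rewrite addrC.
Qed.

Lemma symbol_of_root (R : comPzRingType) i j m (u u' b c : R) p (g t : St R) :
  (0 < p)%N -> i != j -> i != m -> j != m -> u ^+ p = 1 -> b * b = 0 ->
  c ^+ p = 1 + b ->
  is_diag g (diag2 i m u u') (diag2 i m u' u) ->
  is_diag t (diag2 i j (1 + b) (1 - b)) (diag2 i j (1 - b) (1 + b)) ->
  commute g t.
Proof.
move=> p0 ij im jm up b0 cp gD tD.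
have bb : (1 + b) * (1 - b) = 1 by ring: b0.
pose c' := c ^+ p.-1 * (1 - b).
have cc' : c * c' = 1 by rewrite /c' mulrA -exprS prednK // cp bb.
have c'p : c' ^+ p = 1 - b.
  rewrite /c' exprMn -exprM mulnC exprM cp -[in (1 - b) ^+ p](prednK p0) exprSr.
  by rewrite mulrA -exprMn bb expr1n mul1r.
by apply: (symbol_root p0 ij im jm up cc' gD); rewrite cp c'p.
Qed.

(** * The rings Z[G]/p^k and Z[G]/p^k Gamma *)

Section Main.
Variables (p n k : nat) (G : finGroupType) (Gamma : {pred grpring rat G}).
Implicit Types (x : grpring int G) (y : grpring rat G) (m : nat).
Hypothesis p_pr : prime p.
Hypothesis cG : abelian [set: G].
Hypothesis oG : #|G| = (p ^ n)%N.
Hypothesis Gp : forall g : G, (g ^+ p = 1)%g.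
Hypothesis Gamma_ring : subring_closed Gamma.
Hypothesis ZGamma : contains_ZG Gamma.
Hypothesis Gamma_int : forall y, y \in Gamma ->
  forall g, exists c : int, (y g : rat) *+ #|G| = c%:~R.
Hypothesis ltnk : (n < k)%N.

Let N := (p ^ k)%N.

Let G1 : 1 \in Gamma. Proof. by have [] := Gamma_ring. Qed.
Let GB : {in Gamma &, forall y y', y - y' \in Gamma}.
Proof. by have [] := Gamma_ring. Qed.
Let GM : {in Gamma &, forall y y', y * y' \in Gamma}.
Proof. by have [] := Gamma_ring. Qed.
Let G0 : 0 \in Gamma. Proof. by rewrite -(subrr 1) GB. Qed.
Let GD : {in Gamma &, forall y y', y + y' \in Gamma}.
Proof. by move=> y y' yG y'G; rewrite -[y']opprK GB // -[- y']sub0r GB. Qed.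

(** Commutativity is added on the same carrier, so that [K2 Aring] is convertible to the group in
    the theorem. *)
Definition Aring : comPzRingType :=
  let T := fun x : grpring int G => x = N%:R in
  HB.pack (ring_quot T) (GRing.PzRing_hasCommutativeMul.Build (ring_quot T)
    (ring_quot_mulC (@grpring_mulC G int cG))).

Definition Bring : comPzRingType :=
  let T := scaled_order N Gamma in
  HB.pack (ring_quot T) (GRing.PzRing_hasCommutativeMul.Build (ring_quot T)
    (ring_quot_mulC (@grpring_mulC G int cG))).

Definition toA x : Aring := ring_quot_pi _ x.

Lemma toA_eq0 x : toA x = 0 <-> exists x', x = x' *+ N.
Proof. by rewrite -ideal_gen_natr; apply: ring_quot_pi_eq0. Qed.

Lemma toAD : {morph toA : x x' / x + x'}. Proof. exact: ring_quot_piD. Qed.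
Lemma toAM : {morph toA : x x' / x * x'}. Proof. exact: ring_quot_piM. Qed.
Lemma toA0 : toA 0 = 0. Proof. exact: ring_quot_pi0. Qed.
Lemma toAMn x m : toA (x *+ m) = toA x *+ m. Proof. exact: ring_quot_piMn. Qed.

Lemma toA_surj (a : Aring) : exists x, a = toA x.
Proof. exact: ring_quot_piP. Qed.

Lemma toA_N x : toA x *+ N = 0.
Proof. by rewrite -toAMn; apply/toA_eq0; exists x. Qed.

Lemma ideal_scaled x : x \in ideal_gen (scaled_order N Gamma) <->
  scaled_order N Gamma x.
Proof.
split=> [/asboolP[t [tS ->]]|Sx]; last first.
  apply/asboolP; exists [:: (1, x, 1)]; split; last by rewrite big_seq1 mul1r mulr1.
  by move=> u; rewrite inE => /eqP->.
rewrite big_seq; apply: big_ind => [|x1 x2 [y1 y1G E1] [y2 y2G E2]|u /tS[y yG E]].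
- by exists 0; rewrite // grpring_ZtoQ0 mul0rn.
- by exists (y1 + y2); [apply: GD | rewrite grpring_ZtoQD E1 E2 mulrnDl].
exists (grpring_ZtoQ u.1.1 * y * grpring_ZtoQ u.2).
  by apply: GM; [apply: GM|]; rewrite // ZGamma.
by rewrite !grpring_ZtoQM E mulrnAr mulrnAl.
Qed.

(* For y in Gamma and m >= n, [pmulZG m y] is p^m y, read in Z[G]. *)
Definition pmulZG m y : grpring int G := [ffun g => numq ((y g : rat) *+ p ^ m)].

Lemma ZtoQ_pmulZG m y : (n <= m)%N -> y \in Gamma ->
  grpring_ZtoQ (pmulZG m y) = y *+ p ^ m.
Proof.
move=> nm yG; apply/ffunP => g; rewrite !ffunE.
have -> : (y *+ p ^ m) g = (y g : rat) *+ p ^ m by rewrite ffunMnE.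
have [c E] := Gamma_int yG g.
rewrite -(subnKC nm) expnD mulrnA -oG E -rmorphMn /=.
by rewrite numq_int.
Qed.

Definition pmul m y : Aring := toA (pmulZG m y).

Lemma pmulM m m' y y' : (n <= m)%N -> (n <= m')%N -> y \in Gamma -> y' \in Gamma ->
  pmul m y * pmul m' y' = pmul (m + m') (y * y').
Proof.
move=> nm nm' yG y'G; rewrite /pmul -toAM; congr toA; apply: grpring_ZtoQ_inj.
rewrite grpring_ZtoQM !ZtoQ_pmulZG //; [|exact: leq_trans (leq_addr _ _)|exact: GM].
by rewrite mulrnAl mulrnAr -mulrnA expnD mulnC.
Qed.

Lemma pmulD m y y' : (n <= m)%N -> y \in Gamma -> y' \in Gamma ->
  pmul m (y + y') = pmul m y + pmul m y'.
Proof.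
move=> nm yG y'G; rewrite /pmul -toAD; congr toA; apply: grpring_ZtoQ_inj.
by rewrite grpring_ZtoQD !ZtoQ_pmulZG ?GD // mulrnDl.
Qed.

Lemma pmulX m m' y : (n <= m)%N -> y \in Gamma -> pmul m y *+ p ^ m' = pmul (m + m') y.
Proof.
move=> nm yG; rewrite /pmul -toAMn; congr toA; apply: grpring_ZtoQ_inj.
rewrite grpring_ZtoQMn !ZtoQ_pmulZG //; last exact: leq_trans (leq_addr _ _).
by rewrite -mulrnA expnD.
Qed.

(** p^m y is p^k times p^(m-k) y, and the latter lies in Z[G] because m - k >= n. *)
Lemma pmul0 m y : (n + k <= m)%N -> y \in Gamma -> pmul m y = 0.
Proof.
move=> nkm yG; have nmk : (n <= m - k)%N.
  by rewrite leq_subRL ?(leq_trans (leq_addl _ _) nkm) // addnC.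
rewrite -[m](subnK (leq_trans (leq_addl _ _) nkm)) -pmulX //.
exact: toA_N.
Qed.

Lemma pmulZ m x y : (n <= m)%N -> y \in Gamma ->
  toA x * pmul m y = pmul m (grpring_ZtoQ x * y).
Proof.
move=> nm yG; rewrite /pmul -toAM; congr toA; apply: grpring_ZtoQ_inj.
by rewrite grpring_ZtoQM !ZtoQ_pmulZG ?GM // mulrnAr.
Qed.

Definition kerI (a : Aring) := exists2 y, y \in Gamma & a = pmul k y.
Definition baseS (a : Aring) := exists g, a = toA (grpring_basis g).

Let nk := ltnW ltnk.

Lemma kerI0 : kerI 0.
Proof.
exists 0 => //; rewrite /pmul -toA0; congr toA; apply: grpring_ZtoQ_inj.
by rewrite ZtoQ_pmulZG // grpring_ZtoQ0 mul0rn.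
Qed.

Lemma kerID b b' : kerI b -> kerI b' -> kerI (b + b').
Proof. by move=> [y yG ->] [y' y'G ->]; exists (y + y'); rewrite ?pmulD ?GD. Qed.

Lemma kerIM a b : kerI b -> kerI (a * b).
Proof.
move=> [y yG ->]; have [x ->] := toA_surj a.
by exists (grpring_ZtoQ x * y); rewrite ?pmulZ ?GM.
Qed.

Lemma kerI_sq b b' : kerI b -> kerI b' -> b * b' = 0.
Proof.
by move=> [y yG ->] [y' y'G ->]; rewrite pmulM // pmul0 ?GM // leq_add2r.
Qed.

Lemma kerI_half b : kerI b ->
  exists2 b0, b = b0 + b0 & forall b', kerI b' -> b0 * b' = 0.
Proof.
move=> bI; have [p2|p_odd] := even_prime p_pr.
  have [y yG ->] := bI; have nk1 : (n <= k.-1)%N.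
    by rewrite -ltnS prednK // (leq_ltn_trans _ ltnk).
  exists (pmul k.-1 y).
    rewrite -mulr2n -[X in _ *+ X]expn1 -[in RHS]p2 pmulX // addn1 prednK //.
    exact: leq_ltn_trans ltnk.
  move=> b' [y' y'G ->]; rewrite pmulM //; apply: pmul0; last exact: GM.
  by rewrite leq_add2r.
(* N = p^k is odd here, and (N + 1)/2 inverts 2 modulo N. *)
exists (b *+ (N.+1)./2) => [|b' b'I]; last by rewrite mulrnAl kerI_sq // mul0rn.
have [y yG ->] := bI; rewrite -mulr2n -mulrnA muln2 -[in LHS](addr0 (pmul k y)).
have Nodd : odd N by rewrite oddX p_odd orbT.
rewrite even_halfK; last by rewrite /= Nodd.
by rewrite mulrSr toA_N add0r addr0.
Qed.

Lemma baseS_unit u : baseS u -> exists u', u * u' = 1.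
Proof.
move=> [g ->]; exists (toA (grpring_basis g^-1%g)).
by rewrite -toAM grpring_basisM mulgV grpring_basis1.
Qed.

Lemma baseS_gen (P : Aring -> Prop) : P 0 ->
  (forall a u, baseS u -> P a -> P (a + u)) -> forall a, P a.
Proof.
move=> P0 PS a; have [x ->] := toA_surj a.
have PM a' u m : baseS u -> P a' -> P (a' + u *+ m).
  move=> Su Pa; elim: m => [|m IHm]; first by rewrite addr0.
  by rewrite mulrSr addrA; apply: PS.
have natE x' (c : int) : exists m, toA (x' *~ c) = toA x' *+ m.
  case: c => m; first by exists m; rewrite -pmulrn toAMn.
  (* -(m + 1) is congruent to (m + 1)(N - 1) modulo N, so additions alone reach negative
     multiples. *)
  exists (m.+1 * N.-1)%N; apply: (addIr (toA (x' *+ m.+1))).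
  rewrite -toAD NegzE mulrNz -pmulrn addNr toA0 toAMn -mulrnDr.
  rewrite -mulnSr prednK ?expn_gt0 ?prime_gt0 //.
  by rewrite mulnC mulrnA toA_N mul0rn.
rewrite (grpring_sum_basis x).
suff: forall a', P a' -> P (a' + toA (\sum_g grpring_basis g *~ x g)).
  by move/(_ 0 P0); rewrite add0r.
elim/big_rec: _ => [a'|g x' _ IHx a' Pa']; first by rewrite toA0 addr0.
rewrite toAD addrA; apply: IHx; have [m ->] := natE (grpring_basis g) (x g).
by apply: PM => //; exists g.
Qed.

Lemma baseSX u : baseS u -> u ^+ p = 1.
Proof.
move=> [g ->]; have toAX x m : toA x ^+ m = toA (x ^+ m).
  by elim: m => [|m IHm] //; rewrite !exprS IHm toAM.
by rewrite toAX -grpring_basisX Gp grpring_basis1.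
Qed.

(** Take 1 + z with z = p^(k-1) y. As pz = b and z^3 = 0, only C(p,2) z^2 is in the way; it vanishes
    for odd p because p z^2 = 0. *)
Lemma kerI_root b : ~~ [&& p == 2, n == 1 & k == 2]%N -> kerI b ->
  exists c : Aring, c ^+ p = 1 + b.
Proof.
move=> nsp [y yG ->]; have p_gt0 := prime_gt0 p_pr.
(* For n = 0 the ideal is zero; z^3 = 0 below needs 3(k - 1) >= n + k, hence n > 0. *)
have [n0|n_gt0] := posnP n.
  by exists 1; rewrite expr1n pmul0 ?addr0 // n0 add0n.
have nk1 : (n <= k.-1)%N by rewrite -ltnS prednK // (leq_ltn_trans _ ltnk).
have yyG : y * y \in Gamma by apply: GM.
have yyyG : y * y * y \in Gamma by apply: GM.
have pz m y' : (n <= m)%N -> y' \in Gamma -> pmul m y' *+ p = pmul m.+1 y'.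
  by move=> nm y'G; rewrite -[p in LHS]expn1 pmulX // addn1.
pose z := pmul k.-1 y.
have zp : z *+ p = pmul k y by rewrite pz // prednK // (leq_ltn_trans _ ltnk).
have zz : z * z = pmul (k.-1 + k.-1) (y * y) by rewrite pmulM.
have zzz : z * z * z = 0.
  by rewrite zz pmulM ?pmul0 //; lia.
have [c2|c2] := boolP (z * z *+ 'C(p, 2) == 0).
  by exists (1 + z); rewrite expr1D_cube // (eqP c2) addr0 zp.
have zzp : z * z *+ p = 0 by rewrite zz pz ?pmul0 //; lia.
have p2 : p = 2%N.
  have [//|p_odd] := even_prime p_pr; case/eqP: c2.
  have /dvdnP[q ->] : (p %| 'C(p, 2))%N.
    by apply: prime_dvd_bin => //; case: (p) p_pr p_odd => [|[|[|]]].
  by rewrite mulnC mulrnA zzp mul0rn.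
have kE : k = n.+1.
  apply/eqP; rewrite eqn_leq ltnk andbT leqNgt; apply: contra c2 => kn2.
  by rewrite p2 zz pmul0 ?mul0rn //; move: kn2 ltnk; clear; lia.
(* Here z^2 survives mod 2^k; it is cancelled by replacing z with z - z^2 / 2. *)
have n2 : (2 <= n)%N by move: nsp; rewrite p2 kE; case: (n) n_gt0 => [|[|]].
(* w is z^2 / 2. The product zw is 2^(3n-1) y^3, which vanishes because 3n - 1 >= n + k = 2n + 1 for
   n >= 2. *)
pose w := pmul (n + n).-1 (y * y).
have wz : w *+ p = z * z by rewrite /w pz // ?zz; [congr (pmul _ _) | ]; lia.
have nw : (n <= (n + n).-1)%N by lia.
have zw : z * w = 0 by rewrite pmulM //; apply: pmul0; [lia | apply: GM].
have ww : w * w = 0 by rewrite pmulM //; apply: pmul0; [lia | apply: GM].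
exists (1 + z - w); rewrite -zp p2 expr2 !mulr2n; rewrite p2 mulr2n in wz.
by move/esym: wz => wz; ring: zw ww wz.
Qed.

(** With z = 2y = a + cg, the square z^2 = 2(2y^2) lies in 2 Z[G], and its coefficient at 1 is a^2 +
    c^2. So a and c have the same parity, and b = 2z modulo 4 depends only on it. *)
Lemma kerI_small b g : p = 2%N -> n = 1%N -> k = 2%N -> g != 1%g -> kerI b ->
  let u := toA (grpring_basis g) in b = 0 \/ b = 1 + u + (1 + u).
Proof.
move=> p2 n1 k2 g1 [y yG ->] u; pose z := pmulZG 1 y.
have EE : pmul k y = toA z + toA z.
  rewrite -mulr2n -[toA z]/(pmul 1 y).
  by have := @pmulX 1 1 y; rewrite n1 expn1 p2 k2 => ->.
have zz : z * z = pmulZG 1 (y * y) *+ 2.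
  apply: grpring_ZtoQ_inj; rewrite grpring_ZtoQM grpring_ZtoQMn !ZtoQ_pmulZG ?n1 //.
    by rewrite p2 expn1 mulrnAl mulrnAr.
  exact: GM.
have /eqP GE : [set 1%g; g] == [set: G].
  by rewrite eqEcard subsetT cardsT oG p2 n1 cards2 eq_sym g1.
have sumG (V : nmodType) (F : G -> V) : \sum_h F h = F 1%g + F g.
  transitivity (\sum_(h in [set: G]) F h); first by apply: eq_bigl => h; rewrite inE.
  by rewrite -GE big_setU1 ?big_set1 // inE eq_sym.
pose a := z 1%g : int; pose c := z g : int.
have [d ac] : exists d, a * a + c * c = d *+ 2 :> int.
  exists (pmulZG 1 (y * y) 1%g); have /ffunP/(_ 1%g) := zz; rewrite ffunMnE => <-.
  have gg : (g^-1 = g)%g by apply/mulg1_eq; have := Gp g; rewrite p2.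
  by rewrite [in RHS]ffunE sumG invg1 !mulg1 gg.
have [e ce] : exists e : int, c = a + e *+ 2.
  by exists ((c - a) %/ 2)%Z; rewrite -mulr_natr; nia.
have [r [e' ae]] : exists r : bool, exists e' : int, a = r%:R + e' *+ 2.
  by exists (a %% 2 == 1)%Z, (a %/ 2)%Z; rewrite -mulr_natr; lia.
have zE : z = 1 *~ a + grpring_basis g *~ c.
  by rewrite {1}(grpring_sum_basis z) sumG grpring_basis1.
have four : (1 + 1 + 1 + 1 : Aring) = 0.
  by have := toA_N 1; rewrite /N p2 k2 => <-; rewrite !mulrSr mulr0n add0r.
have zA : toA z = a%:~R + u * c%:~R.
  rewrite zE toAD -[toA (1 *~ a)]/(ring_quot_pi _ _) ring_quot_piMz.
  by rewrite -[toA (_ *~ c)]/(ring_quot_pi _ _) ring_quot_piMz mulrzr.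
have E4 (q s t w : Aring) : q + (s + s) + w * (q + (s + s) + (t + t)) +
    (q + (s + s) + w * (q + (s + s) + (t + t))) =
    q * (1 + w + (1 + w)) + (1 + 1 + 1 + 1) * (s + w * (s + t)) by ring.
rewrite EE zA ce ae !rmorphD /= !rmorphMn /= !mulr1z E4.
rewrite four mul0r addr0; case: (r); [right | left]; first by rewrite mulr1n mul1r.
by rewrite mulr0n mul0r.
Qed.

Lemma base_symbol (u u' b : Aring) i j m (g t : St Aring) :
  baseS u -> u * u' = 1 -> kerI b -> i != j -> i != m -> j != m ->
  is_diag g (diag2 i m u u') (diag2 i m u' u) ->
  is_diag t (diag2 i j (1 + b) (1 - b)) (diag2 i j (1 - b) (1 + b)) ->
  commute g t.
Proof.
move=> Su uu' Ib ij im jm gD tD.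
have [/and3P[/eqP p2 /eqP n1 /eqP k2]|nsp] :=
  boolP [&& p == 2, n == 1 & k == 2]%N; last first.
  have [c cp] := kerI_root nsp Ib.
  exact: symbol_of_root (prime_gt0 p_pr) ij im jm (baseSX Su) (kerI_sq Ib Ib) cp gD tD.
have up := baseSX Su; have b0 := kerI_sq Ib Ib; have [h uE] := Su.
(* For u = 1 the element g acts trivially, hence is central. *)
have [h1|h1] := eqVneq h 1%g.
  have u1 : u = 1 by rewrite uE h1 grpring_basis1.
  have u'1 : u' = 1 by rewrite -uu' u1 mul1r.
  apply: K2_central; apply/K2P; have [gd _] := gD.
  apply/funext => v; rewrite gd; apply/funext => l; rewrite u1 u'1 /diag2.
  by do 2?[case: eqP => _]; rewrite mul1r.
have [bE|bE] := kerI_small p2 n1 k2 h1 Ib.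
  apply: (symbol_of_root (c := 1) (prime_gt0 p_pr) ij im jm up b0 _ gD tD).
  by rewrite expr1n bE addr0.
have uu : u * u = 1 by rewrite -up p2 expr2.
have four : 1 + 1 + (1 + 1) = 0 :> Aring.
  by have := toA_N 1; rewrite /N p2 k2 => <-; rewrite !mulrSr mulr0n add0r addrA.
by rewrite -uE in bE; rewrite bE in tD; apply: symbol_order2 uu four gD tD.
Qed.

Let natr_scaled x : x \in ideal_gen (fun x : grpring int G => x = N%:R) ->
  x \in ideal_gen (scaled_order N Gamma).
Proof.
move=> /ideal_gen_natr[x' ->]; apply/ideal_scaled; exists (grpring_ZtoQ x') => //.
exact: grpring_ZtoQMn.
Qed.

Definition reduction_fun (a : Aring) : Bring := quot_map (scaled_order N Gamma) a.

Lemma reduction_zmod : zmod_morphism reduction_fun.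
Proof. exact: quot_map_zmod natr_scaled. Qed.

Lemma reduction_monoid : monoid_morphism reduction_fun.
Proof. exact: quot_map_monoid natr_scaled. Qed.

Definition reduction : {rmorphism Aring -> Bring} :=
  HB.pack reduction_fun (GRing.isZmodMorphism.Build Aring Bring reduction_fun reduction_zmod)
    (GRing.isMonoidMorphism.Build Aring Bring reduction_fun reduction_monoid).

Lemma reduction_surj (b : Bring) : exists a, reduction a = b.
Proof.
have [x ->] := @ring_quot_piP _ (scaled_order N Gamma) b.
by exists (toA x); apply: quot_map_pi natr_scaled _.
Qed.

Lemma reduction_ker a : reduction a = 0 <-> kerI a.
Proof.
have [x ->] := toA_surj a.
have -> : reduction (toA x) = ring_quot_pi (scaled_order N Gamma) x.
  exact: quot_map_pi natr_scaled _.
split=> [/ring_quot_pi_eq0/ideal_scaled[y yG xE]|[y yG xE]].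
  exists y => //; congr toA; apply: grpring_ZtoQ_inj.
  by rewrite ZtoQ_pmulZG.
have /ring_quot_eqP/ideal_gen_natr[x' x'E] := xE.
apply/ring_quot_pi_eq0/ideal_scaled; exists (y + grpring_ZtoQ x'); first exact: GD.
rewrite -[x](subrK (pmulZG k y)) x'E grpring_ZtoQD ZtoQ_pmulZG // grpring_ZtoQMn.
by rewrite mulrnDl addrC.
Qed.

Lemma K2_reduction_iso : group_iso (K2 Aring) (K2 Bring).
Proof.
exact: (K2_square_zero_iso kerI0 kerID kerIM kerI_sq kerI_half baseS_unit
  baseS_gen base_symbol reduction_surj reduction_ker).
Qed.


End Main.

Theorem mainTheorem4 (p n : nat) (G : finGroupType)
    (Gamma : {pred grpring rat G}) (k : nat) :
  prime p ->
  (p.-abelem [set: G])%g ->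
  ('r([set: G]) = n)%g ->
  maximal_Zorder Gamma ->
  contains_ZG Gamma ->
  (n + 1 <= k)%N ->
  group_iso
    (K2 (ring_quot (fun x : grpring int G => x = (p ^ k)%:R)))
    (K2 (ring_quot (scaled_order (p ^ k) Gamma))).
Proof.
move=> p_pr abelG rG [ordG _] ZG; rewrite addn1 => nk.
have cG := abelem_abelian abelG.
have oG : #|G| = (p ^ n)%N.
  by rewrite -rG (rank_abelem abelG) -cardsT -(card_pgroup (abelem_pgroup abelG)).
have Gp (g : G) : (g ^+ p = 1)%g.
  by have [_ ->] := abelemP p_pr abelG; rewrite ?inE.
have [Gring _ _] := ordG.
exact: (K2_reduction_iso p_pr cG oG Gp Gring ZG
  (fun y yG => Zorder_integral cG ordG ZG yG) nk).
Qed.
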